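(* Let $g_1,\dots,g_m\in\mathbb R[\mathbf x]$ and let $\mathcal X=\{\mathbf x\in\mathbb R^n:g_i(\mathbf x)\ge0,\ i\in[m]\}$ be non-empty and compact. Suppose $\mathcal X$ satisfies the Constraint Qualification Condition (CQC): for every $\mathbf x\in\mathcal X$, the gradients $\{\nabla g_i(\mathbf x):i\in[m],\ g_i(\mathbf x)=0\}$ of the active constraints are linearly independent. Then for every fixed positive integer $k$, $\mathbf d_k(\mathcal T(\mathcal X)_{2r})=O(1/r)$ as $r\to\infty$, and the convergence rates of the reduced moment-SOS hierarchy and of the Schmüdgen-type moment-SOS hierarchy are $O(1/r)$: for every $f\in\mathbb R[\mathbf x]$ with $f_{\min}=\min_{\mathcal X}f$, the quantities $f_{\min}-\mathrm{mlb}(f,\mathcal R(\mathcal X))_r$, $f_{\min}-\mathrm{lb}(f,\mathcal R(\mathcal X))_r$, $f_{\min}-\mathrm{mlb}(f,\mathcal T(\mathcal X))_r$ and $f_{\min}-\mathrm{lb}(f,\mathcal T(\mathcal X))_r$ are all $O(1/r)$.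
   Context: Standing convention: for some $R\ge1$ with $\mathcal X\subset\{\|\mathbf x\|\le R\}$, the redundant ball constraint $g_0=R^2-\|\mathbf x\|^2\ge0$ is added to the description used to form the hierarchies. There are no equality constraints, so the reduced certificate $\mathcal R(\mathcal X)_{2r}$ coincides with the truncated preordering $\mathcal T(\mathcal X)_{2r}$ (and the two hierarchies coincide). Notation: $[m]=\{1,\dots,m\}$; $\lceil g\rceil=\lceil(\deg g)/2\rceil$; for $J\subset\{0,\dots,m\}$, $g_J=\prod_{j\in J}g_j$, $g_\emptyset=1$; $\Sigma[\mathbf x]_{2s}$ = sums of squares of degree $\le2s$; $\mathbb N^n_k=\{\alpha\in\mathbb N^n:|\alpha|\le k\}$. $\mathcal R(\mathcal X)_{2r}=\mathcal T(\mathcal X)_{2r}=\{\sum_{J,\lceil g_J\rceil\le r}\sigma_Jg_J:\sigma_J\in\Sigma[\mathbf x]_{2(r-\lceil g_J\rceil)}\}$; $\mathrm{lb}(f,\cdot)_r=\sup\{a\in\mathbb R:f-a\in(\cdot)_{2r}\}$. For $y=(y_\alpha)_{\alpha\in\mathbb N^n_{2r}}$, $\ell_y(f)=\sum f_\alpha y_\alpha$, $\mathbf M_t(gy)=(\ell_y(g\,\mathbf x^{\alpha+\beta}))_{\alpha,\beta\in\mathbb N^n_t}$, $\mathbf M_t(y)=\mathbf M_t(1\,y)$; $\mathcal M(\mathcal R(\mathcal X)_{2r})=\mathcal M(\mathcal T(\mathcal X)_{2r})=\{y:y_0=1,\mathbf M_r(y)\succeq0,\mathbf M_{r-\lceil g_J\rceil}(g_Jy)\succeq0\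 \forall J\subset\{0,\dots,m\},\lceil g_J\rceil\le r\}$; $\mathrm{mlb}(f,\cdot)_r$ is the infimum of $\ell_y(f)$ over this set. $\mathcal M_k(\mathcal T(\mathcal X)_{2r})$ is the image of $\mathcal M(\mathcal T(\mathcal X)_{2r})$ under restriction to indices in $\mathbb N^n_k$; $\mathcal M_k(\mathcal X)=\{(\int\mathbf x^\alpha d\nu)_{\alpha\in\mathbb N^n_k}:\nu\text{ a probability measure on }\mathcal X\}$; $\mathbf d_k(\mathcal T(\mathcal X)_{2r})=\sup\{\inf_{z\in\mathcal M_k(\mathcal X)}\|y-z\|:y\in\mathcal M_k(\mathcal T(\mathcal X)_{2r})\}$. *)

(* Defs.v *)
From mathcomp Require Import all_boot all_order all_algebra.
From mathcomp Require Import all_classical all_reals all_analysis.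
(* mpoly's notations clash with those of all_analysis. *)
From mathcomp.multinomials Require Import -(notations) mpoly.

Set Implicit Arguments.
Unset Strict Implicit.
Unset Printing Implicit Defensive.

Import Order.TTheory GRing.Theory Num.Theory.
Import numFieldNormedType.Exports.

Local Open Scope classical_set_scope.
Local Open Scope ring_scope.

Notation "{ 'mpoly' T [ n ] }" := (mpoly n T) (format "{ 'mpoly'  T [ n ] }").

(* The finite set N^n_d of exponents of total degree at most d ([bmultinom n b]
   bounds the degree strictly). *)
Notation mexp n d := (bmultinom n d.+1).

Section Polynomials.
Variables (R : realType) (n : nat).
Implicit Types (p q : {mpoly R[n]}) (x : 'rV[R]_n).

Definition peval p x : R := meval (x ord0) p.

Definition grad p x : 'rV[R]_n := \row_(i < n) peval (mderiv i p) x.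

(* [mmeasure mdeg p] is 1 + deg p when p != 0, and 0 when p = 0. *)
Definition pdeg p : nat := (mmeasure mdeg p).-1.

Definition hdeg p : nat := uphalf (pdeg p).

Definition enorm x : R := Num.sqrt (\sum_(i < n) x ord0 i ^+ 2).

Definition sos_deg (s : nat) : set {mpoly R[n]} :=
  [set p | (exists qs : seq {mpoly R[n]}, p = \sum_(q <- qs) q ^+ 2) /\
           (pdeg p <= 2 * s)%N].

Definition ball_poly (rad : R) : {mpoly R[n]} :=
  mpolyC n (rad ^+ 2) - \sum_(i < n) mpolyX R (mnm1 i) ^+ 2.

Definition is_min_on p (X : set 'rV[R]_n) (v : R) : Prop :=
  (exists2 x, X x & peval p x = v) /\ (forall x, X x -> v <= peval p x).

End Polynomials.

Section Feasible.
Variables (R : realType) (n m : nat) (g : 'I_m -> {mpoly R[n]}).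

Definition feasible : set 'rV[R]_n := [set x | forall i, 0 <= peval (g i) x].

(* The gradients are taken as a family: a repeated gradient is a dependency. *)
Definition CQC : Prop := forall x, feasible x ->
  free [seq grad (g i) x | i <- enum 'I_m & peval (g i) x == 0].

(* The family g_0, g_1, ..., g_m: index 0 is the ball constraint and index i+1
   carries the i-th element of g. *)
Definition with_ball (rad : R) (j : 'I_m.+1) : {mpoly R[n]} :=
  if unlift ord0 j is Some i then g i else ball_poly n rad.

End Feasible.

Section Hierarchies.
Variables (R : realType) (n l : nat) (g : 'I_l -> {mpoly R[n]}).

Definition gprod (J : {set 'I_l}) : {mpoly R[n]} := \prod_(j in J) g j.

Definition preordering (r : nat) : set {mpoly R[n]} :=
  [set p | exists2 sigma : {set 'I_l} -> {mpoly R[n]},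
     forall J, (hdeg (gprod J) <= r)%N ->
       sos_deg (r - hdeg (gprod J)) (sigma J) &
     p = \sum_(J : {set 'I_l} | (hdeg (gprod J) <= r)%N) sigma J * gprod J].

(* Without equality constraints the reduced certificate is the truncated
   preordering. *)
Definition reduced : nat -> set {mpoly R[n]} := preordering.

(* Terms of degree > d are ignored: [riesz y p] is the intended value when
   deg p <= d. *)
Definition riesz (d : nat) (y : {ffun mexp n d -> R}) (p : {mpoly R[n]}) : R :=
  \sum_(a : mexp n d) mcoeff a p * y a.

Definition loc_matrix (d t : nat) (q : {mpoly R[n]}) (y : {ffun mexp n d -> R})
    (a b : mexp n t) : R :=
  riesz y (q * mpolyX R (mnm_add a b)).

Definition psd (I : finType) (M : I -> I -> R) : Prop :=
  (forall i j, M i j = M j i) /\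
  (forall c : I -> R, 0 <= \sum_i \sum_j c i * M i j * c j).

Definition moment_preordering (r : nat) : set {ffun mexp n (2 * r) -> R} :=
  [set y : {ffun mexp n (2 * r) -> R} | [/\ y bm0 = 1,
     psd (loc_matrix (t := r) 1 y) &
     forall J : {set 'I_l}, (hdeg (gprod J) <= r)%N ->
       psd (loc_matrix (t := r - hdeg (gprod J)) (gprod J) y)]].

Definition moment_reduced : forall r : nat, set {ffun mexp n (2 * r) -> R} :=
  moment_preordering.

End Hierarchies.

Section Bounds.
Variables (R : realType) (n : nat).
Local Open Scope ereal_scope.

Definition lb (f : {mpoly R[n]}) (Q : nat -> set {mpoly R[n]}) (r : nat) :
    \bar R :=
  ereal_sup [set a%:E | a in [set a : R | Q r (f - mpolyC n a)%R]].

Definition mlb (f : {mpoly R[n]})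
    (M : forall r : nat, set {ffun mexp n (2 * r) -> R}) (r : nat) : \bar R :=
  ereal_inf [set (riesz y f)%:E | y in M r].

(* The restriction of y to the exponents of degree <= k (meant for k <= d; any
   missing coordinate is 0). *)
Definition mom_restrict (d k : nat) (y : {ffun mexp n d -> R}) :
    {ffun mexp n k -> R} :=
  [ffun a : mexp n k =>
     if (insub (bmnm a) : option (mexp n d)) is Some b then y b else (0 : R)%R].

Definition mvec_dist (k : nat) (y z : {ffun mexp n k -> R}) : R :=
  Num.sqrt (\sum_a (y a - z a) ^+ 2).

(* R^n with its Borel sigma-algebra. *)
Definition borel_rV := g_sigma_algebraType (@open 'rV[R]_n).

Definition moments_on (X : set 'rV[R]_n) (k : nat) :
    set {ffun mexp n k -> R} :=
  [set z | exists2 nu : probability borel_rV R, nu X = 1 &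
     forall a : mexp n k,
       (z a)%:E = \int[nu]_(x in X) (peval (mpolyX R a) x)%:E].

Definition moment_dist (X : set 'rV[R]_n)
    (M : forall r : nat, set {ffun mexp n (2 * r) -> R}) (k r : nat) : \bar R :=
  ereal_sup [set ereal_inf [set (mvec_dist y z)%:E | z in @moments_on X k]
            | y in mom_restrict k @` M r].

(* u r = O(1/r) as r -> oo; it forces u r to be finite for all large r. *)
Definition bigO_inv (u : nat -> \bar R) : Prop :=
  exists C : R, \forall r \near \oo, `|u r| <= (C / r%:R)%:E.

End Bounds.

(* Main.v *)
(* Let [f >= b] on the feasible set X. By CQC the penalty [viol], the sum of the
   negative parts of the constraints, has slope bounded away from zero near X, so
   [F = f - b + c * viol] is nonnegative on the box [-rad, rad]^n for some [c]
   proportional to the Lipschitz constant of [f]. On the box two facts hold: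
   (i) a positive kernel of Jackson type sends a nonnegative Lipschitz function to
   an element of the truncated preordering of degree O(N), within O(1/N) of it;
   (ii) if [p] has degree at most N and is bounded by [c] on the box, then
   [p + 3 ^ n * c] lies in the preordering truncated at degree O(N), because a de la
   Vallee-Poussin kernel reproduces [p] and is a difference of two Fejer kernels,
   which are themselves certificates.
   Let [q] be a polynomial of degree O(N) within O(1/N) of the negative part, let
   P = f - b + c * sum_i q(g_i), and let K be the certificate (i) for [F]. In
     f - b = (P - K) + K - c * sum_i q(g_i)
   the first term is O(1/N) on the box and is handled by (ii), and [O(1/N) - q(g_i)]
   is handled by the univariate form of (ii) on an interval [0, Ga], as [q] is O(1/N)
   there. Hence [f - b + O(1/r)] lies in the preordering truncated at degree [2 r],
   uniformly over [f] of bounded degree and Lipschitz constant. This bounds [lb] and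
   [mlb]; applied to the linear form supporting the convex hull of the moment vectors
   of points of X at a near-projection, it bounds the moment distance. *)

Require Import Defs.
From HB Require Import structures.
From mathcomp Require Import all_boot all_order all_algebra.
From mathcomp Require Import all_classical all_reals all_analysis.
From mathcomp.multinomials Require Import -(notations) mpoly.
From mathcomp Require Import measurable_realfun ring lra zify.
Import Order.TTheory GRing.Theory Num.Theory.
Import numFieldNormedType.Exports.
Local Open Scope classical_set_scope.
Local Open Scope ring_scope.

Set Implicit Arguments.
Unset Strict Implicit.
Unset Printing Implicit Defensive.

(** * Chebyshev kernels *)

Section Chebyshev.
Variable R : realType.
Implicit Types (k l e d N M : nat) (t : R) (a : nat -> R) (p q : {poly R}).

(** The angle addition formulas with ['X] for [cos t]: the pair stands for [cos (k t)] and
    [sin (k t) / sin t], which lets [ring] prove trigonometric identities. *)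
Fixpoint chebTS k : {poly R} * {poly R} :=
  if k is k'.+1 then
    let: (p, q) := chebTS k' in ('X * p - (1 - 'X^2) * q, 'X * q + p)
  else (1, 0).

Definition chebT k : {poly R} := (chebTS k).1.

(* [chebS k] is the Chebyshev polynomial of the second kind of index [k - 1]. *)
Definition chebS k : {poly R} := (chebTS k).2.

Lemma chebT0 : chebT 0 = 1. Proof. by []. Qed.
Lemma chebS0 : chebS 0 = 0. Proof. by []. Qed.

Lemma chebTSr k : chebT k.+1 = 'X * chebT k - (1 - 'X^2) * chebS k.
Proof. by rewrite /chebT /chebS /=; case: (chebTS k). Qed.

Lemma chebSSr k : chebS k.+1 = 'X * chebS k + chebT k.
Proof. by rewrite /chebT /chebS /=; case: (chebTS k). Qed.

Lemma size_1subX2 : (size (1 - 'X^2 : {poly R})%R <= 3)%N.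
Proof.
by apply: (leq_trans (size_polyD _ _)); rewrite size_polyN size_polyXn size_poly1.
Qed.

Lemma size_cheb k : (size (chebT k) <= k.+1)%N /\ (size (chebS k) <= k)%N.
Proof.
elim: k => [|k [IT IS]]; first by rewrite chebT0 chebS0 size_poly1 size_poly0.
have mulX (p : {poly R}) j : (size p <= j)%N -> (size ('X * p)%R <= j.+1)%N.
  by move=> pj; apply: (leq_trans (size_polyMleq _ _)); rewrite size_polyX.
split; rewrite ?chebTSr ?chebSSr.
  apply: (leq_trans (size_polyD _ _)); rewrite geq_max size_polyN mulX //=.
  apply: (leq_trans (size_polyMleq _ _)).
  by have := size_1subX2; lia.
by apply: (leq_trans (size_polyD _ _)); rewrite geq_max mulX.
Qed.

Lemma horner_cheb k t :
  (chebT k).[cos t] = cos (k%:R * t) /\ (chebS k).[cos t] * sin t = sin (k%:R * t).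
Proof.
elim: k => [|k [IT IS]].
  by rewrite chebT0 chebS0 hornerC horner0 !mul0r cos0 sin0.
have -> : k.+1%:R * t = k%:R * t + t by rewrite -[k.+1]addn1 natrD; ring.
rewrite chebTSr chebSSr !hornerE IT cosD sinD -IS; split; last by ring.
by rewrite -[1 - cos t ^+ 2]sin2cos2; ring.
Qed.

(** The cosine subtraction formula in polynomial form. The recursion acts as a rotation, as
    ['X^2 + (1 - 'X^2) = 1], so raising [k] leaves the left side unchanged. *)
Lemma chebTM k d :
  chebT (d + k) * chebT k + (1 - 'X^2) * (chebS (d + k) * chebS k) = chebT d.
Proof.
elim: k => [|k <-]; first by rewrite addn0 chebT0 chebS0; ring.
by rewrite addnS !chebTSr !chebSSr; ring.
Qed.

Lemma chebTM_dist k l :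
  chebT k * chebT l + (1 - 'X^2) * (chebS k * chebS l) = chebT `|k - l|%N.
Proof.
wlog lek : k l / (l <= k)%N.
  move=> H; case: (leqP l k) => [/H // | /ltnW /H].
  by rewrite distnC => <-; rewrite mulrC [chebS k * _]mulrC.
by rewrite -{1 2}(subnK lek) chebTM distnEl.
Qed.

Lemma cos_dist k l t : cos (`|k - l|%N%:R * t) =
  cos (k%:R * t) * cos (l%:R * t) + sin (k%:R * t) * sin (l%:R * t).
Proof.
wlog lek : k l / (l <= k)%N.
  move=> H; case: (leqP l k) => [/H // | /ltnW /H].
  by rewrite distnC => ->; ring.
by rewrite distnEl // natrB // mulrBl cosB.
Qed.

(** A shape that is visibly nonnegative on [[-1, 1]]. In [kern], averaging over [s - t] and [s + t]
    cancels the cross terms, which are odd in [sin s], and leaves these squares. *)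
Definition sqkern (u1 u2 w1 w2 : {poly R}) : {poly R} :=
  u1 ^+ 2 + u2 ^+ 2 + (1 - 'X^2) * (w1 ^+ 2 + w2 ^+ 2).

(* As a function of [cos s], half the sum of [|A(s - t)|^2] and [|A(s + t)|^2],
   where [A s = \sum_k a k * expi (k s)]. *)
Definition kern a N t : {poly R} :=
  sqkern (\sum_(k < N) (a k * cos (k%:R * t)) *: chebT k)
         (\sum_(k < N) (a k * sin (k%:R * t)) *: chebT k)
         (\sum_(k < N) (a k * cos (k%:R * t)) *: chebS k)
         (\sum_(k < N) (a k * sin (k%:R * t)) *: chebS k).

(** The squares expand into sums over pairs of frequencies. The subtraction formula, used once in
    [t] and once in the polynomial variable, merges each pair into its difference. *)
Lemma kernE a N t : kern a N t =
  \sum_(k < N) \sum_(l < N)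
    (a k * a l * cos (`|k - l|%N%:R * t)) *: chebT `|k - l|%N.
Proof.
have sq (b : nat -> R) (p : nat -> {poly R}) : (\sum_(k < N) b k *: p k) ^+ 2 =
    \sum_(k < N) \sum_(l < N) (b k * b l) *: (p k * p l).
  rewrite expr2 mulr_suml; apply: eq_bigr => k _; rewrite mulr_sumr.
  by apply: eq_bigr => l _; rewrite -scalerAl -scalerAr scalerA.
rewrite /kern /sqkern !(sq (fun k => a k * _ (k%:R * t))).
rewrite -!big_split mulr_sumr -big_split; apply: eq_bigr => k _ /=.
rewrite -!big_split mulr_sumr -big_split; apply: eq_bigr => l _ /=.
by rewrite cos_dist -chebTM_dist -!mul_polyC !rmorphM !rmorphD !rmorphM /=; ring.
Qed.

Definition grid M (j : nat) : R := j%:R * (pi *+ 2 / M%:R).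

Lemma sum_cos_grid M k : (k < M)%N ->
  \sum_(j < M) cos (k%:R * grid M j) = M%:R * (k == 0%N)%:R :> R.
Proof.
case: (posnP k) => [-> M0 | k0 kM] /=.
  rewrite (eq_bigr (fun=> 1)) => [|j _]; last by rewrite mul0r cos0.
  by rewrite sumr_const card_ord mulr1.
have M0n : (0 < M)%N by lia.
have M0 : 0 < M%:R :> R by rewrite ltr0n.
rewrite mulr0.
pose b : R := k%:R * pi / M%:R.
have sb : 0 < sin b.
  apply: sin_gt0_pi; rewrite /b divr_gt0 ?mulr_gt0 ?pi_gt0 ?ltr0n //=.
  by rewrite ltr_pdivrMr // mulrC ltr_pM2l ?pi_gt0 // ltr_nat.
apply: (mulfI (lt0r_neq0 sb)); rewrite mulr0 mulr_sumr.
(* The product [sin b * cos (2 j b)] is half of [sin ((2 j + 1) b) - sin ((2 j - 1) b)]. The sum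
   telescopes, and its two ends differ by [k] full periods. *)
pose h (j : nat) : R := sin ((j.*2%:R - 1) * b) / 2.
rewrite (eq_bigr (fun j : 'I_M => h j.+1 - h j)) => [|j _]; last first.
  rewrite /h doubleS -addn2 natrD -addrA (_ : 2%:R - 1 = 1 :> R); last by ring.
  have -> : k%:R * grid M j = j.*2%:R * b.
    by rewrite /grid /b -muln2 natrM; field; rewrite lt0r_neq0.
  by rewrite !mulrDl mulN1r mul1r sinD sinB; field.
rewrite -(big_mkord xpredT (fun j => h j.+1 - h j)) telescope_sumr // /h.
rewrite double0 sub0r mulN1r sinN.
have -> : (M.*2%:R - 1) * b = - b + pi *+ 2 *+ k.
  rewrite /b -muln2 natrM -[_ *+ k]mulr_natr -[pi *+ 2]mulr_natr; field.
  by rewrite lt0r_neq0.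
by rewrite (periodicn (@sinD2pi R)) sinN; ring.
Qed.

(** Discrete orthogonality. The bound on [M] keeps both frequencies of the product-to-sum formula
    below [M], so there is no aliasing. For [e = 0] and [k = l] both indicators equal one. *)
Lemma sum_cos_grid2 M N e k l : (e + N <= M)%N -> (k < N)%N -> (l < N)%N ->
  \sum_(j < M) cos (e%:R * grid M j) * cos (`|k - l|%N%:R * grid M j) =
  M%:R / 2 * ((k == l + e)%N + (l == k + e)%N)%:R :> R.
Proof.
move=> eN kN lN; have dN : (`|k - l| < N)%N by lia.
set d := `|k - l|%N in dN *.
rewrite (eq_bigr (fun j : 'I_M => 2^-1 * (cos ((e + d)%N%:R * grid M j) +
   cos (`|e - d|%N%:R * grid M j)))) => [|j _]; last first.
  by rewrite cos_dist natrD mulrDl cosD; field.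
rewrite -mulr_sumr big_split /= !sum_cos_grid; [|lia|lia].
rewrite -mulrDr mulrA [2^-1 * _]mulrC -natrD; congr (_ * _%:R).
by rewrite /d; lia.
Qed.

Definition autocorr a N e : R := \sum_(l < N | (l + e < N)%N) a l * a (l + e)%N.

Lemma sum_shift a N e :
  \sum_(k < N) \sum_(l < N) a k * a l * (k == l + e :> nat)%N%:R = autocorr a N e.
Proof.
rewrite exchange_big /autocorr [RHS]big_mkcond; apply: eq_bigr => l _ /=.
case: ltnP => leN; last first.
  by rewrite big1 // => k _; have := ltn_ord k; case: eqP => [|_]; [lia|rewrite mulr0].
rewrite (bigD1 (Ordinal leN)) //= eqxx mulr1 big1 ?addr0 1?mulrC // => k.
by rewrite -val_eqE /= => /negPf ->; rewrite mulr0.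
Qed.

(** Discrete convolution with the kernel is diagonal on Chebyshev polynomials, since orthogonality
    keeps only the pairs with [|k - l| = e]. Designing a kernel thus amounts to choosing an
    autocorrelation. *)
Lemma kern_chebT a N M e : (e + N <= M)%N ->
  \sum_(j < M) (chebT e).[cos (grid M j)] *: kern a N (grid M j) =
  (M%:R * autocorr a N e) *: chebT e.
Proof.
move=> eN.
pose w (k l : nat) : R := ((k == l + e)%N + (l == k + e)%N)%:R.
transitivity (\sum_(k < N) \sum_(l < N) (a k * a l * (M%:R / 2 * w k l)) *: chebT e).
  under eq_bigr => j _ do rewrite kernE scaler_sumr.
  rewrite exchange_big; apply: eq_bigr => k _ /=.
  under eq_bigr => j _ do rewrite scaler_sumr.
  rewrite exchange_big; apply: eq_bigr => l _ /=.
  under eq_bigr => j _ do rewrite scalerA (horner_cheb e _).1 mulrCA.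
  rewrite -scaler_suml -mulr_sumr (@sum_cos_grid2 M N) // -/(w k l).
  case: (eqVneq `|k - l|%N e) => [-> // | ne].
  by rewrite /w (_ : (_ + _)%N = 0%N) ?mulr0 ?scale0r //; lia.
under eq_bigr => k _ do rewrite -scaler_suml.
rewrite -scaler_suml; congr (_ *: _).
pose f (k l : nat) : R := a k * a l * (k == l + e)%N%:R.
transitivity (M%:R / 2 * (\sum_(k < N) \sum_(l < N) f k l +
                          \sum_(k < N) \sum_(l < N) f l k)).
  rewrite -big_split mulr_sumr; apply: eq_bigr => k _ /=.
  rewrite -big_split mulr_sumr; apply: eq_bigr => l _ /=.
  by rewrite /f /w natrD; ring.
rewrite [X in _ + X]exchange_big /= !sum_shift; by field.
Qed.


End Chebyshev.

Arguments chebT {R} k.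
Arguments chebS {R} k.
Arguments grid {R} M j.

(** * Kernels of de la Vallee-Poussin and Jackson type *)

Section Kernels.
Variable R : realType.
Implicit Types (k l e d N M : nat) (t : R) (a : nat -> R) (p q : {poly R}).

(** The bounds on [w1] and [w2] are lower by one, so that the part weighted by [1 - 'X^2] also has
    degree at most [2 * N]. *)
Definition Pcert N p := exists (c : R) (u1 u2 w1 w2 : {poly R}),
  [/\ 0 <= c, (size u1 <= N.+1)%N /\ (size u2 <= N.+1)%N,
      (size w1 <= N)%N /\ (size w2 <= N)%N & p = c *: sqkern u1 u2 w1 w2].

Lemma Pcert_kern c a N t : 0 <= c -> Pcert N (c *: kern a N t).
Proof.
move=> c0; have szT (b : nat -> R) : (size (\sum_(k < N) b k *: chebT k)%R <= N.+1)%N.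
  apply: (leq_trans (size_sum _ _ _)); apply/bigmax_leqP => k _.
  by apply: (leq_trans (size_scale_leq _ _)); have := ltn_ord k; have := size_cheb R k; lia.
have szS (b : nat -> R) : (size (\sum_(k < N) b k *: chebS k)%R <= N)%N.
  apply: (leq_trans (size_sum _ _ _)); apply/bigmax_leqP => k _.
  by apply: (leq_trans (size_scale_leq _ _)); have := ltn_ord k; have := size_cheb R k; lia.
pose f (k : nat) := a k * cos (k%:R * t); pose g (k : nat) := a k * sin (k%:R * t).
exists c, (\sum_(k < N) f k *: chebT k), (\sum_(k < N) g k *: chebT k),
  (\sum_(k < N) f k *: chebS k), (\sum_(k < N) g k *: chebS k).
by split => //; split.
Qed.

Lemma Pcert_le N M p : (N <= M)%N -> Pcert N p -> Pcert M p.
Proof.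
move=> NM [c [u1 [u2 [w1 [w2 [c0 [su1 su2] [sw1 sw2] ->]]]]]].
by exists c, u1, u2, w1, w2; split => //; split; lia.
Qed.

Lemma Pcert_ge0 N p t : Pcert N p -> `|t| <= 1 -> 0 <= p.[t].
Proof.
move=> [c [u1 [u2 [w1 [w2 [c0 _ _ ->]]]]]] t1; rewrite /sqkern !hornerE.
have t2 : 0 <= 1 - t ^+ 2 by rewrite subr_ge0 -real_normK ?num_real // expr_le1.
apply: mulr_ge0 => //; apply: addr_ge0; last apply: mulr_ge0 => //.
  by rewrite addr_ge0 ?sqr_ge0.
by rewrite addr_ge0 ?sqr_ge0.
Qed.

Lemma chebTSS k : chebT k.+2 = 2 *: ('X * chebT k.+1) - chebT k :> {poly R}.
Proof. by rewrite [chebT k.+2]chebTSr chebSSr !chebTSr -mul_polyC; ring. Qed.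

Lemma chebT_span N (P : {poly R} -> Prop) :
    (forall p q, P p -> P q -> P (p + q)) ->
    (forall (c : R) p, P p -> P (c *: p)) ->
    (forall k, (k <= N)%N -> P (chebT k)) ->
  forall p, (size p <= N.+1)%N -> P p.
Proof.
move=> PD PZ PT p sp.
(* Generalized for the induction: a factor ['X] is traded for a shift of [k] by one in either
   direction, which keeps [i + k] within [N]. *)
have PX i k : (i + k <= N)%N -> P ('X^i * chebT k).
  elim: i k => [|i IH] [|k] ikN; rewrite ?mul1r; do ?by apply: PT.
    have -> : 'X^(i.+1) * chebT 0 = 'X^i * chebT 1 :> {poly R}.
      by rewrite chebTSr chebT0 chebS0 exprSr; ring.
    by apply: IH; lia.
  have -> : 'X^(i.+1) * chebT k.+1 = 
      2^-1 *: ('X^i * chebT k.+2 + 'X^i * chebT k) :> {poly R}.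
    rewrite chebTSS exprSr -mulrDr addrNK -!scalerAr scalerA mulVf ?pnatr_eq0 //.
    by rewrite scale1r mulrA.
  by apply/PZ/PD; apply: IH; lia.
rewrite -[p]coefK poly_def.
apply: (big_ind P) => // [|i _]; first by rewrite -(scale0r (chebT 0)); exact/PZ/PT.
apply: PZ; rewrite -['X^i]mulr1 -chebT0; apply: PX.
by have := ltn_ord i; lia.
Qed.

Lemma autocorr1 N e : (e <= N)%N -> autocorr (fun=> 1) N e = (N - e)%N%:R :> R.
Proof.
move=> eN; rewrite /autocorr (eq_bigl (fun l : 'I_N => (l < N - e)%N)); last first.
  by move=> l /=; lia.
rewrite -(big_ord_widen _ (fun=> 1 * 1 : R)) ?leq_subr // sumr_const card_ord.
by rewrite mulr1.
Qed.

(* The kernels come from [2 F_2N - F_N], where [F_N] is the Fejer kernel. *)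
Lemma vallee_poussin N : (0 < N)%N ->
  exists (M : nat) (x : 'I_M -> R) (A B : 'I_M -> {poly R}),
  [/\ forall j, `|x j| <= 1, forall j, Pcert (2 * N) (A j),
      forall j, Pcert (2 * N) (B j), \sum_j (A j + B j) = 3%:P &
      forall p, (size p <= N.+1)%N -> \sum_j p.[x j] *: (A j - B j) = p].
Proof.
(* The degrees go up to [N] and the kernel orders up to [2 * N], so [3 * N] nodes avoid aliasing. *)
move=> N0; pose M := (3 * N)%N.
have NR : N%:R != 0 :> R by rewrite pnatr_eq0; lia.
have MR : M%:R != 0 :> R by rewrite pnatr_eq0; lia.
pose c : R := (M%:R * N%:R)^-1; have c0 : 0 <= c by rewrite invr_ge0 mulr_ge0.
(* With this scaling the multipliers for [K = 2 * N] and [K = N] are [(2 N - e) / N] and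
   [(N - e) / N]: their difference is 1 for every [e <= N], and their sum at [e = 0] is 3. *)
pose F (K : nat) (j : 'I_M) := c *: kern (fun=> 1) K (grid M j).
have FT K e : (e <= K)%N -> (e + K <= M)%N ->
    \sum_(j < M) (chebT e).[cos (grid M j)] *: F K j = ((K - e)%N%:R / N%:R) *: chebT e.
  move=> eK eM; under eq_bigr => j _ do rewrite /F scalerA mulrC -scalerA.
  rewrite -scaler_sumr kern_chebT // scalerA autocorr1 //; congr (_ *: _).
  by rewrite /c; field; rewrite NR MR.
exists M, (fun j => cos (grid M j)), (F (2 * N)%N), (F N); split.
- by move=> j; exact: cos_max.
- by move=> j; exact: Pcert_kern.
- by move=> j; apply: (@Pcert_le N); [lia | exact: Pcert_kern].
- have F1 K : (K <= M)%N -> \sum_j F K j = (K%:R / N%:R)%:P.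
    move=> KM; have := FT K 0%N (leq0n _) KM.
    rewrite chebT0 subn0 alg_polyC => <-.
    by apply: eq_bigr => j _; rewrite hornerC scale1r.
  rewrite big_split /= !F1 -?polyCD /M; [|lia|lia].
  by congr _%:P; rewrite natrM; field.
- apply: chebT_span => [p q Hp Hq|d p Hp|k kN].
  + rewrite -[in RHS]Hp -[in RHS]Hq -big_split /=.
    by apply: eq_bigr => j _; rewrite hornerD scalerDl.
  + rewrite -[in RHS]Hp scaler_sumr.
    by apply: eq_bigr => j _; rewrite hornerZ scalerA.
  + under eq_bigr => j _ do rewrite scalerBr.
    rewrite big_split /= sumrN !FT /M; [|lia..].
    rewrite -scalerBl !natrB ?natrM; [|lia..].
    by rewrite -[RHS]scale1r; congr (_ *: _); field.
Qed.

Lemma sin_le t : 0 <= t -> sin t <= t.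
Proof.
move=> t0; have dsin x : x \in `]0, t[ -> is_derive x 1 sin (cos x : R).
  by move=> _; exact: is_derive_sin.
have [|c _] := MVT_segment t0 dsin.
  by apply: continuous_subspaceT; exact: continuous_sin.
by rewrite sin0 !subr0 => ->; rewrite ler_piMl // cos_le1.
Qed.

Lemma cos_ge t : 0 <= t <= pi -> 1 - cos t <= t ^+ 2 / 2.
Proof.
move=> /andP[t0 tpi].
have h0 : 0 <= t / 2 by rewrite divr_ge0.
have s0 : 0 <= sin (t / 2).
  by apply: sin_ge0_pi; rewrite h0 /= (le_trans _ tpi) // ler_pdivrMr // ler_peMr // ler1n.
have : sin (t / 2) ^+ 2 <= (t / 2) ^+ 2 by rewrite ler_sqr ?nnegrE // sin_le.
rewrite sin2cos2.
have -> : cos t = cos (t / 2) ^+ 2 *+ 2 - 1.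
  by rewrite -cos_mulr2n; congr cos; rewrite -mulr_natr; field.
by rewrite -mulr_natr => ?; lra.
Qed.

(* Korovkin's choice [a k = sin ((k + 1) w)], [w = pi / (N + 1)]: it is the top
   eigenvector, for the eigenvalue [cos w], of the form
   [\sum_l a l * a l.+1] relative to [\sum_l a l ^+ 2]. *)
Lemma autocorr_sin N (w := pi / N.+1%:R : R) (a := fun k : nat => sin (k.+1%:R * w)) :
  autocorr a N 1 = cos w * autocorr a N 0.
Proof.
(* The sine vanishes at both ends of the range, so the forward and the backward shifted sums both
   equal [autocorr a N 1]; the recurrence [aD] then averages them. *)
have aN : a N = 0 by rewrite /a /w mulrC divfK ?pnatr_eq0 // sinpi.
have aD k : a k * cos w *+ 2 = a k.+1 + sin (k%:R * w).
  have -> : k%:R * w = k.+1%:R * w - w by rewrite -[k.+1]addn1 natrD; ring.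
  rewrite /a (_ : k.+2%:R * w = k.+1%:R * w + w); last first.
    by rewrite -[k.+2]addn1 natrD; ring.
  by rewrite sinD sinB; ring.
have E1 : autocorr a N 1 = \sum_(l < N) a l * a l.+1.
  rewrite /autocorr big_mkcond; apply: eq_bigr => l _ /=; rewrite addn1.
  case: ltnP => // Nl; suff -> : l.+1 = N by rewrite aN mulr0.
  by have := ltn_ord l; lia.
have E0 : autocorr a N 0 = \sum_(l < N) a l * a l.
  by apply: eq_big => [l|l _]; rewrite addn0 // ltn_ord.
have E2 : autocorr a N 1 = \sum_(l < N) a l * sin (l%:R * w).
  have := @big_ord_recr R 0 +%R N (fun l : 'I_N.+1 => a l * sin (l%:R * w)).
  rewrite big_ord_recl /= aN !mul0r sin0 mulr0 add0r addr0 E1 => <-.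
  by apply: eq_bigr => l _; rewrite mulrC.
apply: (mulIf (_ : 2 != 0)); first by rewrite pnatr_eq0.
rewrite mulr_natr mulr2n {1}E1 E2 E0 -big_split mulr_sumr mulr_suml /=.
by apply: eq_bigr => l _; rewrite -mulrDr -aD -mulr_natr; ring.
Qed.

(** The second moment at [y] involves only the multipliers of [chebT 1] and [chebT 2]: it is a
    combination of [1 - la 1] and [1 - la 2], both of order [1 / N ^ 2]. *)
Lemma korovkin_moment2 N : (0 < N)%N ->
  exists (M : nat) (x : 'I_M -> R) (J : 'I_M -> {poly R}),
  [/\ forall j, `|x j| <= 1, forall j, Pcert N (J j), \sum_j J j = 1 &
      forall y, `|y| <= 1 ->
        \sum_j (J j).[y] * (x j - y) ^+ 2 <= 32 / N%:R ^+ 2].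
Proof.
(* Chebyshev degrees up to 2 occur, hence [N + 2] nodes. *)
move=> N0; pose M := N.+2; pose w : R := pi / N.+1%:R.
pose a (k : nat) : R := sin (k.+1%:R * w).
have w0 : 0 < w by rewrite divr_gt0 ?pi_gt0 ?ltr0n.
have wpi : w <= pi by rewrite ler_pdivrMr ?ltr0n // ler_peMr ?pi_ge0 // ler1n.
pose s := autocorr a N 0.
have s0 : 0 < s.
  rewrite /s /autocorr; case: N N0 @M @w @a w0 wpi @s => // N _ M w a w0 wpi s.
  rewrite big_mkcond big_ord_recl /=; apply: ltr_pwDl.
    rewrite addn0 -expr2 exprn_gt0 // /a mul1r; apply: sin_gt0_pi.
    rewrite w0 /= /w ltr_pdivrMr ?ltr0n // ltr_pMr ?pi_gt0 // ltr1n //.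
  by apply: sumr_ge0 => i _; case: ifP => // _; rewrite addn0 -expr2 sqr_ge0.
have MR : M%:R != 0 :> R by rewrite pnatr_eq0.
pose x (j : 'I_M) : R := cos (grid M j).
pose J (j : 'I_M) := (M%:R * s)^-1 *: kern a N (grid M j).
pose la e := autocorr a N e / s.
have JT e : (e <= 2)%N -> \sum_(j < M) (chebT e).[x j] *: J j = la e *: chebT e.
  move=> e2; under eq_bigr => j _ do rewrite /J scalerA mulrC -scalerA.
  rewrite -scaler_sumr kern_chebT ?/M; last by lia.
  rewrite scalerA; congr (_ *: _).
  rewrite /la; field; rewrite (lt0r_neq0 s0) /=.
  by move: MR; rewrite /M -[N.+2]addn2 natrD addrC.
have J1 : \sum_j J j = 1.
  have := JT 0%N isT; rewrite chebT0 /la -/s divff ?lt0r_neq0 // scale1r => <-.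
  by apply: eq_bigr => j _; rewrite hornerC scale1r.
have JP j : Pcert N (J j) by apply: Pcert_kern; rewrite invr_ge0 mulr_ge0 // ltW.
have Jge0 j y : `|y| <= 1 -> 0 <= (J j).[y] by exact: Pcert_ge0.
clearbody J.
have x1 j : `|x j| <= 1 by exact: cos_max.
have chebT1 : chebT 1 = 'X :> {poly R} by rewrite chebTSr chebT0 chebS0; ring.
have chebT2 : chebT 2 = 2 *: 'X^2 - 1 :> {poly R}.
  by rewrite chebTSS chebT1 chebT0 -expr2.
have E0 y : \sum_j (J j).[y] = 1 by rewrite -horner_sum J1 hornerC.
have E1 y : \sum_j (J j).[y] * x j = la 1%N * y.
  have /(congr1 (horner^~ y)) := JT 1%N isT.
  rewrite chebT1 horner_sum !hornerE => <-.
  by apply: eq_bigr => j _; rewrite hornerZ hornerX mulrC.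
have E2 y : \sum_j (J j).[y] * (2 * x j ^+ 2 - 1) = la 2%N * (2 * y ^+ 2 - 1).
  have /(congr1 (horner^~ y)) := JT 2%N isT.
  rewrite chebT2 horner_sum !hornerE => <-.
  by apply: eq_bigr => j _; rewrite hornerZ mulrC !hornerE.
have la1 : la 1%N = cos w by rewrite /la autocorr_sin mulfK // lt0r_neq0.
have n1 : `|1| <= 1 :> R by rewrite normr1.
(* Positivity of the kernel at [y = 1]: the integrand is [2 * (1 - x j) ^ 2]. *)
have la2 : 1 - la 2%N <= 4 * (1 - la 1%N).
  have : 0 <= \sum_j (J j).[1] * (4 * (1 - x j) - (1 - (2 * x j ^+ 2 - 1))).
    apply: sumr_ge0 => j _; rewrite mulr_ge0 ?Jge0 //.
    have := x1 j; rewrite ler_norml => /andP[]; nra.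
  rewrite (eq_bigr (fun j => (J j).[1] * 3 - 4 * ((J j).[1] * x j) +
    (J j).[1] * (2 * x j ^+ 2 - 1))) => [|j _]; last by ring.
  by rewrite !big_split /= sumrN -mulr_sumr -mulr_suml E0 E1 E2; lra.
have la2' : la 2%N <= 1.
  have : 0 <= \sum_j (J j).[1] * (1 - (2 * x j ^+ 2 - 1)).
    apply: sumr_ge0 => j _; rewrite mulr_ge0 ?Jge0 //.
    have := x1 j; rewrite ler_norml => /andP[]; nra.
  under eq_bigr => j _ do rewrite mulrBr mulr1.
  by rewrite big_split /= sumrN E0 E2; lra.
have la1' : 1 - la 1%N <= 8 / N%:R ^+ 2.
  rewrite la1; apply: (le_trans (cos_ge _)); first by rewrite ltW.
  have pi4 : pi <= 4 :> R by have := @pihalf_lt2 R; lra.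
  have : w <= 4 / N%:R.
    rewrite /w ler_pM ?invr_ge0 ?pi_ge0 // lef_pV2 ?posrE ?ltr0n // ler_nat //.
  have -> : 8 / N%:R ^+ 2 = (4 / N%:R) ^+ 2 / 2 :> R.
    by field; rewrite pnatr_eq0; lia.
  move=> w4; rewrite ler_pM2r ?invr_gt0 ?ltr0n //.
  by rewrite ler_sqr ?nnegrE // ltW // (lt_le_trans w0).
exists M, x, J; split => // y y1.
have y2 : 0 <= y ^+ 2 <= 1 by rewrite sqr_ge0 -real_normK ?num_real //= expr_le1.
rewrite (eq_bigr (fun j => (J j).[y] * (2^-1 + y ^+ 2) -
  2 * y * ((J j).[y] * x j) + 2^-1 * ((J j).[y] * (2 * x j ^+ 2 - 1))))
  => [|j _]; last by field.
rewrite !big_split /= sumrN -!mulr_sumr -mulr_suml E0 E1 E2.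
have -> : 32 / N%:R ^+ 2 = 4 * (8 / N%:R ^+ 2) :> R by ring.
apply: le_trans (ler_wpM2l _ la1') => //.
set z := y ^+ 2 in y2 *; rewrite (_ : 2 * y * _ = 2 * la 1%N * z); last by rewrite /z; ring.
by nra.
Qed.

(* AM-GM: turns the bound on second moments into one on mean deviations. *)
Lemma norm_le_sqr (e d : R) : 0 < e -> `|d| <= (d ^+ 2 / e + e) / 2.
Proof.
move=> e0; have e0' : e != 0 by rewrite gt_eqF.
rewrite -subr_ge0 -(pmulr_rge0 _ e0) -(@pmulr_rge0 _ 2) //.
rewrite (_ : 2 * _ = (`|d| - e) ^+ 2) ?sqr_ge0 //.
by rewrite -(real_normK (num_real d)); field.
Qed.

(** AM-GM at scale [1 / N] turns the second moment [32 / N ^ 2] into [16 / N + 1 / (2 N)], which is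
    below [17 / N]. *)
Lemma jackson N : (0 < N)%N ->
  exists (M : nat) (x : 'I_M -> R) (J : 'I_M -> {poly R}),
  [/\ forall j, `|x j| <= 1, forall j, Pcert N (J j), \sum_j J j = 1 &
      forall y, `|y| <= 1 -> \sum_j (J j).[y] * `|x j - y| <= 17 / N%:R].
Proof.
move=> N0; have [M [x [J [x1 JP J1 JE]]]] := korovkin_moment2 N0.
exists M, x, J; split=> // y y1.
have e0 : 0 < N%:R^-1 :> R by rewrite invr_gt0 ltr0n.
have N0' : N%:R != 0 :> R by rewrite pnatr_eq0; lia.
have JS : \sum_j (J j).[y] = 1 by rewrite -horner_sum J1 hornerC.
apply: (@le_trans _ _ (\sum_j ((J j).[y] * (x j - y) ^+ 2 * (N%:R / 2) +
                               (J j).[y] * (N%:R^-1 / 2)))).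
  apply: ler_sum => j _; rewrite -mulrA -mulrDr ler_wpM2l ?(Pcert_ge0 (JP j)) //.
  by apply: (le_trans (norm_le_sqr _ e0)); rewrite invrK mulrDl mulrA.
rewrite big_split /= -!mulr_suml JS mul1r.
apply: (@le_trans _ _ (32 / N%:R ^+ 2 * (N%:R / 2) + N%:R^-1 / 2)).
  by rewrite lerD2r ler_wpM2r ?divr_ge0 // JE.
rewrite (_ : _ + _ = 33 / 2 * N%:R^-1); last by field.
by rewrite ler_wpM2r ?invr_ge0 // ler_pdivrMr // -natrM ler_nat.
Qed.

End Kernels.

(** * Certificates in truncated preorderings *)

Section Degree.
Variables (R : realType) (n : nat).
Implicit Types (p q u : {mpoly R[n]}).

Lemma pdegC c : pdeg (mpolyC n c : {mpoly R[n]}) = 0%N.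
Proof. by rewrite /pdeg mmeasureC; case: (c != 0). Qed.

Lemma pdeg1 : pdeg (1 : {mpoly R[n]}) = 0%N.
Proof. exact: (pdegC 1). Qed.

Lemma pdeg0 : pdeg (0 : {mpoly R[n]}) = 0%N.
Proof. by rewrite /pdeg mmeasure0. Qed.

Lemma pdegX (a : multinom n) : pdeg (mpolyX R a) = mdeg a.
Proof. by rewrite /pdeg msizeX. Qed.

Lemma pdegN p : pdeg (- p) = pdeg p.
Proof. by rewrite /pdeg mmeasureN. Qed.

Lemma pdegD_le p q d : (pdeg p <= d)%N -> (pdeg q <= d)%N -> (pdeg (p + q)%R <= d)%N.
Proof. by rewrite /pdeg; have := mmeasureD_le mdeg p q; lia. Qed.

Lemma pdegB_le p q d : (pdeg p <= d)%N -> (pdeg q <= d)%N -> (pdeg (p - q)%R <= d)%N.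
Proof. by move=> pd qd; rewrite pdegD_le ?pdegN. Qed.

Lemma pdeg_sum_le (I : Type) (s : seq I) (P : pred I) (F : I -> {mpoly R[n]}) d :
  (forall i, P i -> (pdeg (F i) <= d)%N) -> (pdeg (\sum_(i <- s | P i) F i)%R <= d)%N.
Proof.
move=> Fd; apply: (big_ind (fun p => pdeg p <= d)%N) => //; first by rewrite pdeg0.
by move=> p q; exact: pdegD_le.
Qed.

Lemma pdegZ_le c p : (pdeg (c *: p)%R <= pdeg p)%N.
Proof. by rewrite /pdeg; have := mmeasureZ_le mdeg p c; lia. Qed.

Lemma pdegM p q : p != 0 -> q != 0 -> pdeg (p * q) = (pdeg p + pdeg q)%N.
Proof.
move=> p0 q0; rewrite /pdeg msizeM //.
have pp : (0 < mmeasure mdeg p)%N by rewrite lt0n mmeasure_poly_eq0.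
have qp : (0 < mmeasure mdeg q)%N by rewrite lt0n mmeasure_poly_eq0.
by move: pp qp; case: (mmeasure _ p) (mmeasure _ q) => [|a] [|b] //; rewrite addnS.
Qed.

Lemma pdegM_le p q : (pdeg (p * q)%R <= pdeg p + pdeg q)%N.
Proof.
have [->|p0] := eqVneq p 0; first by rewrite mul0r pdeg0.
have [->|q0] := eqVneq q 0; first by rewrite mulr0 pdeg0.
by rewrite pdegM.
Qed.

Lemma pdegXn_le p k : (pdeg (p ^+ k)%R <= pdeg p * k)%N.
Proof.
elim: k => [|k IH]; first by rewrite expr0 pdeg1.
by rewrite exprS; have := pdegM_le p (p ^+ k); lia.
Qed.

Lemma pdeg_horner_alg u (p : {poly R}) :
  (pdeg (horner_alg u p) <= pdeg u * (size p).-1)%N.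
Proof.
rewrite -{1}[p]coefK poly_def linear_sum /=; apply: pdeg_sum_le => i _.
rewrite linearZ /= rmorphXn /= horner_algX.
rewrite mulr_algl; apply: (leq_trans (pdegZ_le _ _)).
apply: (leq_trans (pdegXn_le _ _)); rewrite leq_mul // -ltnS prednK //.
by rewrite (leq_ltn_trans _ (ltn_ord i)).
Qed.

Lemma peval_horner_alg u (p : {poly R}) (x : 'rV[R]_n) :
  peval (horner_alg u p) x = p.[peval u x].
Proof.
rewrite -{1}[p]coefK poly_def linear_sum /= /peval rmorph_sum /= horner_coef.
apply: eq_bigr => i _; rewrite linearZ /= rmorphXn /= horner_algX mulr_algl.
by rewrite mevalZ rmorphXn.
Qed.

End Degree.

Section Certificates.
Variables (R : realType) (n l : nat) (g : 'I_l -> {mpoly R[n]}).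
Implicit Types (p q u : {mpoly R[n]}) (r s : nat) (J K : {set 'I_l}).

(* Unlike [preordering], this bounds the degree of each square rather than that of
   their sum, which is what the nonnegativity of [riesz y] needs. *)
Inductive cert r : {mpoly R[n]} -> Prop :=
| cert0 : cert r 0
| certS q J p : (pdeg q + hdeg (gprod g J) <= r)%N -> cert r p ->
    cert r (q ^+ 2 * gprod g J + p).

Lemma certD r p q : cert r p -> cert r q -> cert r (p + q).
Proof.
move=> cp cq; elim: cp => [|u J v uJ _ IH]; first by rewrite add0r.
by rewrite -addrA; exact: certS.
Qed.

Lemma cert_sum r (I : Type) (s : seq I) (P : pred I) (F : I -> {mpoly R[n]}) :
  (forall i, P i -> cert r (F i)) -> cert r (\sum_(i <- s | P i) F i).
Proof. by move=> cF; apply: big_ind => //; [exact: cert0 | exact: certD]. Qed.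

Lemma cert_le r s p : (r <= s)%N -> cert r p -> cert s p.
Proof.
move=> rs; elim=> [|q J v qJ _ IH]; first exact: cert0.
by apply: certS => //; apply: leq_trans rs.
Qed.

Lemma certZ r c p : 0 <= c -> cert r p -> cert r (c *: p).
Proof.
move=> c0; elim=> [|q J v qJ _ IH]; first by rewrite scaler0; exact: cert0.
rewrite scalerDr scalerAl -{1}(sqr_sqrtr c0) -exprZn; apply: certS => //.
by apply: leq_trans qJ; rewrite leq_add2r pdegZ_le.
Qed.

Lemma gprod0 : gprod g finset.set0 = 1.
Proof. by rewrite /gprod big_set0. Qed.

Lemma cert_sqr r q : (pdeg q <= r)%N -> cert r (q ^+ 2).
Proof.
move=> qr; rewrite -[q ^+ 2]mulr1 -gprod0 -[X in cert _ X]addr0.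
by apply: certS; [rewrite gprod0 /hdeg pdeg1 addn0 | exact: cert0].
Qed.

Lemma cert_const r c : 0 <= c -> cert r (mpolyC n c).
Proof.
move=> c0; rewrite -(sqr_sqrtr c0) rmorphXn /=; apply: cert_sqr.
by rewrite pdegC.
Qed.

Lemma cert_gen i : cert (hdeg (g i)) (g i).
Proof.
rewrite -[X in cert _ X]addr0 -[X in cert _ (X + _)]mul1r -(expr1n _ 2).
rewrite (_ : g i = gprod g [set i]); last by rewrite /gprod big_set1.
by apply: certS; [rewrite pdeg1 | exact: cert0].
Qed.

(** Common factors pair up into a square, so a product of two preordering terms is again a term over
    a single index set. *)
Lemma gprodM J K : gprod g J * gprod g K =
  gprod g (J :&: K) ^+ 2 * gprod g ((J :\: K) :|: (K :\: J)).
Proof.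
rewrite /gprod -prodrXl [X in X * _]big_mkcond [X in _ * X]big_mkcond.
rewrite [X in _ = X * _]big_mkcond [X in _ = _ * X]big_mkcond -!big_split /=.
apply: eq_bigr => j _; rewrite !inE.
by case: (j \in J); case: (j \in K); rewrite /= ?mulr1 ?mul1r.
Qed.

Lemma uphalf_add_le (a b i d : nat) :
  (a + b = i + i + d)%N -> (i + uphalf d <= uphalf a + uphalf b)%N.
Proof.
move=> abE; rewrite !uphalf_half.
by have := odd_double_half a; have := odd_double_half b; have := odd_double_half d; lia.
Qed.

(** The order does not grow beyond the sum: degrees satisfy
    [deg g_J + deg g_K = 2 deg g_I + deg g_D], and rounding the two half-degrees on the left up
    separately costs at least as much as on the right. *)
Lemma certM r s p q : cert r p -> cert s q -> cert (r + s) (p * q).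
Proof.
move=> cp cq; elim: cp => [|u J v uJ _ IHp]; first by rewrite mul0r; exact: cert0.
rewrite mulrDl; apply: certD => // {v IHp}.
elim: cq => [|w K v wK _ IHq]; first by rewrite mulr0; exact: cert0.
rewrite mulrDr; apply: certD => // {v IHq}.
rewrite mulrACA gprodM mulrA -!exprMn.
set I := J :&: K; set D := _ :|: _.
(* Degrees are additive only for nonzero factors, so a vanishing product is set apart. *)
have [z|nz] := eqVneq (gprod g J * gprod g K) 0.
  rewrite exprMn -mulrA -gprodM z mulr0; exact: cert0.
rewrite -[X in cert _ X]addr0; apply: certS; last exact: cert0.
have gJ : gprod g J != 0 by apply: contraNneq nz => ->; rewrite mul0r.
have gK : gprod g K != 0 by apply: contraNneq nz => ->; rewrite mulr0.
have gI : gprod g I != 0.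
  by apply: contraNneq nz => I0; rewrite gprodM -/I I0 expr2 !mul0r.
have gD : gprod g D != 0 by apply: contraNneq nz => D0; rewrite gprodM -/D D0 mulr0.
have := congr1 (@pdeg R n) (gprodM J K).
rewrite -/I -/D expr2 (pdegM gJ gK) (pdegM (mulf_neq0 gI gI) gD) (pdegM gI gI) => dE.
have := pdegM_le (u * w) (gprod g I); have := pdegM_le u w.
have := uphalf_add_le dE; move: uJ wK; rewrite /hdeg => h1 h2 h3 h4 h5.
apply: (leq_trans (leq_add (leq_trans h5 (leq_add h4 (leqnn _))) (leqnn _))).
by move: h1 h2 h3; clear; lia.
Qed.

Lemma cert_horner_alg e N u (p : {poly R}) :
  (pdeg u <= e)%N -> cert e (1 - u ^+ 2) -> Pcert N p ->
  cert (e * N) (horner_alg u p).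
Proof.
move=> ue cu [c [u1 [u2 [w1 [w2 [c0 [su1 su2] [sw1 sw2] ->]]]]]].
have sq (v : {poly R}) k : (size v <= k.+1)%N -> cert (e * k) (horner_alg u v ^+ 2).
  move=> vk; apply: cert_sqr; apply: (leq_trans (pdeg_horner_alg _ _)).
  by apply: leq_mul; lia.
rewrite linearZ /= /sqkern mulr_algl !(rmorphD, rmorphM, rmorphXn, rmorphB) /=.
rewrite rmorphN rmorphXn /= rmorph1 horner_algX.
apply: certZ => //; apply: certD; first by apply: certD; apply: sq.
(* For [N = 0] both [w1] and [w2] vanish. Otherwise the weight costs [e] and its squares cost [e]
   times the predecessor. *)
case: N sw1 sw2 {su1 su2} => [|N] sw1 sw2.
  move: sw1 sw2; rewrite !leqn0 !size_poly_eq0 => /eqP-> /eqP->.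
  by rewrite rmorph0 expr2 mul0r addr0 mulr0; exact: cert0.
by rewrite mulnS; apply: certM => //; apply: certD; apply: sq.
Qed.

Lemma cert_preordering r p : cert r p -> preordering g r p.
Proof.
elim=> [|q J v qJ _ [sg sgP ->]].
  exists (fun=> 0) => [J _|]; last by rewrite big1 // => J _; rewrite mul0r.
  by split; [exists [::]; rewrite big_nil | rewrite pdeg0].
exists (fun K => (if K == J then q ^+ 2 else 0) + sg K) => [K Kr|].
  have [[qs ->] dK] := sgP K Kr; case: eqP => [EK|_]; last first.
    by rewrite add0r; split=> //; exists qs.
  split; first by exists (q :: qs); rewrite big_cons.
  apply: pdegD_le => //; apply: (leq_trans (pdegXn_le _ _)).
  by rewrite EK; lia.
rewrite [RHS](eq_bigr (fun K => (if K == J then q ^+ 2 else 0) * gprod g K +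
   sg K * gprod g K)) => [|K _]; last by rewrite mulrDl.
rewrite big_split /=; congr (_ + _).
rewrite (bigD1 J) /=; last by lia.
by rewrite eqxx big1 ?addr0 // => K /andP[_ /negPf->]; rewrite mul0r.
Qed.

Lemma peval_preordering r p (x : 'rV[R]_n) :
  (forall j, 0 <= peval (g j) x) -> preordering g r p -> 0 <= peval p x.
Proof.
move=> gx [sg sgP ->]; rewrite /peval rmorph_sum /=; apply: sumr_ge0 => J Jr.
rewrite rmorphM /= mulr_ge0 //; last first.
  by rewrite rmorph_prod; apply: prodr_ge0 => j _; exact: gx.
have [[qs ->] _] := sgP J Jr.
by rewrite rmorph_sum /=; apply: sumr_ge0 => q _; rewrite rmorphXn /= sqr_ge0.
Qed.

End Certificates.

(** * Approximation on a box *)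

Section Approximation.
Variable R : realType.

Lemma Pcert_size N (p : {poly R}) : (0 < N)%N -> Pcert N p -> (size p <= (2 * N).+1)%N.
Proof.
move=> N0 [c [u1 [u2 [w1 [w2 [c0 [su1 su2] [sw1 sw2] ->]]]]]].
have sq (v : {poly R}) : (size (v ^+ 2)%R <= (size v + size v).-1)%N.
  by rewrite expr2 size_polyMleq.
have D (v w : {poly R}) d : (size v <= d)%N -> (size w <= d)%N -> (size (v + w)%R <= d)%N.
  by move=> vd wd; apply: (leq_trans (size_polyD _ _)); rewrite geq_max vd.
apply: (leq_trans (size_scale_leq _ _)); rewrite /sqkern; apply/D.
  by apply/D; [have := sq u1 | have := sq u2]; lia.
apply: (leq_trans (size_polyMleq _ _)).
have : (size (w1 ^+ 2 + w2 ^+ 2)%R <= (2 * N).-1)%N.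
  by apply/D; [have := sq w1 | have := sq w2]; lia.
by have := size_1subX2 R; lia.
Qed.

(** Nonnegative weights summing to one bound the error at [t] by a mean of [|F (x j) - F t|], which
    the Lipschitz condition reduces to the mean deviation of the nodes. *)
Lemma jackson_approx N (F : R -> R) : (0 < N)%N ->
    (forall s t, `|F s - F t| <= `|s - t|) ->
  exists q : {poly R}, (size q <= (2 * N).+1)%N /\
    forall t : R, `|t| <= 1 -> `|q.[t] - F t| <= 17 / N%:R.
Proof.
move=> N0 FL; have [M [x [J [x1 JP J1 JE]]]] := jackson R N0.
exists (\sum_j F (x j) *: J j); split=> [|t t1].
  apply: (leq_trans (size_sum _ _ _)); apply/bigmax_leqP => j _.
  by apply: (leq_trans (size_scale_leq _ _)); exact: Pcert_size.
have Jt j : 0 <= (J j).[t] by exact: Pcert_ge0 (JP j) t1.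
have St : \sum_j (J j).[t] = 1 by rewrite -horner_sum J1 hornerC.
have -> : F t = \sum_j (J j).[t] * F t by rewrite -mulr_suml St mul1r.
rewrite horner_sum -sumrB; apply: (le_trans (ler_norm_sum _ _ _)).
apply: le_trans (JE t t1); apply: ler_sum => j _.
by rewrite hornerZ mulrC -mulrBr normrM ger0_norm // ler_wpM2l.
Qed.

End Approximation.

Section Box.
Variables (R : realType) (n l : nat) (g : 'I_l -> {mpoly R[n]}).

Definition inbox (rho : R) (x : 'rV[R]_n) := forall i, `|x ord0 i| <= rho.

Lemma cert_pdeg r p : cert g r p -> (pdeg p <= 2 * r)%N.
Proof.
elim=> [|q J v qJ _ IH]; first by rewrite pdeg0.
apply: pdegD_le => //; apply: (leq_trans (pdegM_le _ _)).
move: qJ; have := pdegXn_le q 2; rewrite /hdeg.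
move: (pdeg (gprod g J)) => d; have := odd_double_half d; rewrite uphalf_half.
by move: (pdeg _) (pdeg _) => a b; lia.
Qed.

(* As [\sum_j (A j + B j) = 3], adding [3 c] to [\sum_j p.[x j] *: (A j - B j)]
   makes all the coefficients [c +- p.[x j]] nonnegative. *)
Lemma cert_univ e N u (p : {poly R}) (c : R) : (0 < N)%N -> (pdeg u <= e)%N ->
    cert g e (1 - u ^+ 2) -> (size p <= N.+1)%N ->
    (forall t : R, `|t| <= 1 -> `|p.[t]| <= c) ->
  cert g (e * (2 * N)) (horner_alg u p + mpolyC n (3 * c)).
Proof.
move=> N0 ue cu sp pc; have [M [x [A [B [x1 AP BP AB pE]]]]] := vallee_poussin R N0.
have -> : mpolyC n (3 * c) = horner_alg u (c *: \sum_j (A j + B j)).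
  by rewrite AB -mul_polyC -polyCM mulrC horner_algC -mul_mpolyC mulr1.
rewrite -{1}(pE p sp) -rmorphD /= scaler_sumr -big_split /= linear_sum /=.
apply: cert_sum => j _.
have -> : p.[x j] *: (A j - B j) + c *: (A j + B j) =
    (c + p.[x j]) *: A j + (c - p.[x j]) *: B j.
  by rewrite -!mul_polyC !(rmorphD, rmorphN) /=; ring.
have := pc _ (x1 j); rewrite ler_norml => /andP[c1 c2].
rewrite linearD !linearZ /= !mulr_algl.
apply: certD; apply: certZ; rewrite ?subr_ge0 -?lerBlDl ?sub0r //.
  exact: cert_horner_alg.
exact: cert_horner_alg.
Qed.

Variable rho : R.
Hypothesis rho0 : 0 < rho.

Definition bvar (i : 'I_n) : {mpoly R[n]} := rho^-1 *: mpolyX R (mnm1 i).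

Lemma pdeg_bvar i : (pdeg (bvar i) <= 1)%N.
Proof. by apply: (leq_trans (pdegZ_le _ _)); rewrite pdegX mdeg1. Qed.

Lemma peval_bvar i x : peval (bvar i) x = x ord0 i / rho.
Proof. by rewrite /peval mevalZ mevalXU mulrC. Qed.

Hypothesis cert_bvar : forall i, cert g 1 (1 - bvar i ^+ 2).

Lemma cert_tensor N (A : 'I_n -> {poly R}) : (forall i, Pcert N (A i)) ->
  cert g (n * N) (\prod_i horner_alg (bvar i) (A i)).
Proof.
move=> AP.
suff H (s : seq 'I_n) : cert g (size s * N) (\prod_(i <- s) horner_alg (bvar i) (A i)).
  by have := H (enum 'I_n); rewrite size_enum_ord !big_enum.
elim: s => [|i s IH]; first by rewrite big_nil mul0n; apply: (cert_const _ _ ler01).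
rewrite big_cons mulSn; apply: certM => //.
by rewrite -[N]mul1n; apply: cert_horner_alg => //; exact: pdeg_bvar.
Qed.

(** Expanded, [S + D] and [S - D] are twice the sums of the products with an even, respectively odd,
    number of factors from [B]. The induction adds one coordinate at a time. *)
Lemma cert_tensor_signed N (A B : 'I_n -> {poly R})
    (S := \prod_i horner_alg (bvar i) (A i + B i))
    (D := \prod_i horner_alg (bvar i) (A i - B i)) :
    (forall i, Pcert N (A i)) -> (forall i, Pcert N (B i)) ->
  cert g (n * N) (S + D) /\ cert g (n * N) (S - D).
Proof.
move=> AP BP; rewrite /S /D {S D}.
suff H (s : seq 'I_n) (S := \prod_(i <- s) horner_alg (bvar i) (A i + B i))
    (D := \prod_(i <- s) horner_alg (bvar i) (A i - B i)) :
    cert g (size s * N) (S + D) /\ cert g (size s * N) (S - D).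
  by have := H (enum 'I_n); rewrite size_enum_ord !big_enum.
rewrite {}/S {}/D; elim: s => [|i s [IHp IHm]].
  rewrite !big_nil subrr mul0n; split; last exact: cert0.
  by apply: certD; apply: (cert_const _ _ ler01).
rewrite !big_cons mulSn rmorphD rmorphB /=.
set S := \prod_(_ <- _) _ in IHp IHm *; set D := \prod_(_ <- _) _ in IHp IHm *.
set a := horner_alg _ _; set b := horner_alg _ _.
have ca : cert g N a by rewrite -[N]mul1n; apply: cert_horner_alg => //; exact: pdeg_bvar.
have cb : cert g N b by rewrite -[N]mul1n; apply: cert_horner_alg => //; exact: pdeg_bvar.
split.
  by rewrite (_ : _ + _ = a * (S + D) + b * (S - D)); [apply: certD; apply: certM | ring].
by rewrite (_ : _ - _ = a * (S - D) + b * (S + D)); [apply: certD; apply: certM | ring].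
Qed.

(** The tensor form of [cert_univ]. The sums [S] add up to [3 ^ n] and the differences [D] reproduce
    [p]; in terms of [S + D] and [S - D] the coefficients are half of [c] plus or minus a value of
    [p] at a node in the box. *)
Lemma cert_box N p (c : R) : (0 < N)%N -> (pdeg p <= N)%N ->
    (forall x, inbox rho x -> `|peval p x| <= c) ->
  cert g (n * (2 * N)) (p + mpolyC n (3 ^+ n * c)).
Proof.
move=> N0 pN pc; have [M [x [A [B [x1 AP BP AB qE]]]]] := vallee_poussin R N0.
pose node (f : {ffun 'I_n -> 'I_M}) : 'rV[R]_n := \row_i (rho * x (f i)).
pose S (f : {ffun 'I_n -> 'I_M}) := \prod_i horner_alg (bvar i) (A (f i) + B (f i)).
pose D (f : {ffun 'I_n -> 'I_M}) := \prod_i horner_alg (bvar i) (A (f i) - B (f i)).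
have SE : \sum_f S f = mpolyC n (3 ^+ n).
  rewrite -(bigA_distr_bigA (fun i j => horner_alg (bvar i) (A j + B j))).
  rewrite (eq_bigr (fun=> mpolyC n 3)) => [|i _]; last first.
    by rewrite -linear_sum /= AB horner_algC -mul_mpolyC mulr1.
  by rewrite prodr_const card_ord -rmorphXn.
have DE : \sum_f peval p (node f) *: D f = p.
  (* By linearity monomials suffice; for them the sum over nodes factors over the coordinates, where
     each exponent is at most [N]. *)
  pose V a := \sum_f peval (mpolyX R a) (node f) *: D f.
  have VE a : a \in msupp p -> V a = mpolyX R a.
    move=> ap; have aN i : (a i <= N)%N.
      apply: (@leq_trans (pdeg p)) => //; have := msize_mdeg_lt ap.
      by rewrite /pdeg mdegE (bigD1 i) //=; lia.
    rewrite /V [RHS]mpolyXE_id.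
    rewrite (eq_bigr (fun f : {ffun 'I_n -> 'I_M} => \prod_i ((rho * x (f i)) ^+ a i *:
      horner_alg (bvar i) (A (f i) - B (f i))))) => [|f _]; last first.
      rewrite scaler_prod; congr (_ *: _); rewrite /peval mevalX.
      by apply: eq_bigr => i _; rewrite mxE.
    rewrite -(bigA_distr_bigA (fun i j => (rho * x j) ^+ a i *:
      horner_alg (bvar i) (A j - B j))); apply: eq_bigr => i _.
    rewrite (_ : mpolyX R (mnm1 i) ^+ a i = horner_alg (bvar i) ((rho *: 'X) ^+ a i)).
      rewrite -(qE ((rho *: 'X) ^+ a i)) ?linear_sum; last first.
        rewrite exprZn; apply: (leq_trans (size_scale_leq _ _)).
        by rewrite size_polyXn ltnS.
      apply: eq_bigr => j _; rewrite linearZ /= mulr_algl; congr (_ *: _).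
      by rewrite !hornerE.
    rewrite rmorphXn /= linearZ /= horner_algX mulr_algl /bvar scalerA.
    by rewrite mulfV ?gt_eqF // scale1r.
  rewrite [RHS]mpolyE; rewrite (eq_big_seq (fun a => mcoeff a p *: V a)); last first.
    by move=> a /VE ->.
  under [RHS]eq_bigr => a _ do rewrite scaler_sumr.
  rewrite exchange_big; apply: eq_bigr => f _ /=.
  rewrite {1}(mpolyE p) /peval linear_sum scaler_suml; apply: eq_bigr => a _.
  by rewrite /= mevalZ scalerA.
have -> : p + mpolyC n (3 ^+ n * c) = \sum_f
    (((c + peval p (node f)) / 2) *: (S f + D f) +
     ((c - peval p (node f)) / 2) *: (S f - D f)).
  rewrite mulrC mpolyCM -SE mul_mpolyC scaler_sumr -{1}DE -big_split.
  apply: eq_bigr => f _ /=.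
  have comb (a b : R) : a *: D f + b *: S f =
      ((b + a) / 2) *: (S f + D f) + ((b - a) / 2) *: (S f - D f).
    rewrite -{1}[a](_ : (b + a) / 2 - (b - a) / 2 = a); last by field.
    rewrite -{3}[b](_ : (b + a) / 2 + (b - a) / 2 = b); last by field.
    by rewrite -!mul_mpolyC !(rmorphD, rmorphN) /=; ring.
  exact: comb.
apply: cert_sum => f _.
have /pc : inbox rho (node f).
  by move=> i; rewrite mxE normrM gtr0_norm // ler_piMr // ltW.
rewrite ler_norml => /andP[c1 c2].
have [cS cD] := @cert_tensor_signed (2 * N) (fun i => A (f i)) (fun i => B (f i))
  (fun i => AP (f i)) (fun i => BP (f i)).
by apply: certD; apply: certZ => //; rewrite divr_ge0 //; lra.
Qed.

(** Averaging [F] over a tensor grid against products of Jackson kernels uses only values of [F] in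
    the box, and these are admissible coefficients because [F] is nonnegative there. *)
Lemma box_jackson N (F : 'rV[R]_n -> R) (L : R) : (0 < N)%N -> 0 <= L ->
    (forall x, inbox rho x -> 0 <= F x) ->
    (forall x y, inbox rho x -> inbox rho y ->
      `|F x - F y| <= L * \sum_i `|x ord0 i - y ord0 i|) ->
  exists K : {mpoly R[n]}, cert g (n * N) K /\
    forall y, inbox rho y -> `|peval K y - F y| <= L * (17 * n%:R * rho) / N%:R.
Proof.
move=> N0 L0 F0 FL; have [M [x [J [x1 JP J1 JE]]]] := jackson R N0.
pose node (f : {ffun 'I_n -> 'I_M}) : 'rV[R]_n := \row_i (rho * x (f i)).
have nodeP f : inbox rho (node f).
  by move=> i; rewrite mxE normrM gtr0_norm // ler_piMr // ltW.
pose W (f : {ffun 'I_n -> 'I_M}) := \prod_i horner_alg (bvar i) (J (f i)).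
exists (\sum_f F (node f) *: W f); split=> [|y yB].
  apply: cert_sum => f _; apply: certZ; first exact/F0/nodeP.
  by apply: (@cert_tensor N (fun i => J (f i))).
pose t i := y ord0 i / rho.
have t1 i : `|t i| <= 1.
  by rewrite /t normrM normfV (gtr0_norm rho0) ler_pdivrMr // mul1r.
have Jt j i : 0 <= (J j).[t i] by exact: Pcert_ge0 (JP j) (t1 i).
pose w (f : {ffun 'I_n -> 'I_M}) := \prod_i (J (f i)).[t i].
have w0 f : 0 <= w f by apply: prodr_ge0.
have WE f : peval (W f) y = w f.
  rewrite /W /peval rmorph_prod /=; apply: eq_bigr => i _.
  exact: etrans (peval_horner_alg _ _ _) (congr1 _ (peval_bvar _ _)).
have JS i : \sum_j (J j).[t i] = 1 by rewrite -horner_sum J1 hornerC.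
have wS : \sum_f w f = 1.
  by rewrite -(bigA_distr_bigA (fun i j => (J j).[t i])) big1.
(* Marginalization: the weights of the other coordinates sum to one, which leaves a one-dimensional
   mean deviation. *)
have wM (h : 'I_M -> R) i : \sum_f w f * h (f i) = \sum_j (J j).[t i] * h j.
  pose G i' j := (J j).[t i'] * (if i' == i then h j else 1).
  transitivity (\sum_f \prod_i' G i' ((f : {ffun 'I_n -> 'I_M}) i')).
    apply: eq_bigr => f _; rewrite big_split /=; congr (_ * _).
    by rewrite -big_mkcond big_pred1_eq.
  rewrite -(bigA_distr_bigA G) (bigD1 i) //= [X in _ * X]big1 ?mulr1 => [|i' /negPf i'i].
    by apply: eq_bigr => j _; rewrite /G eqxx.
  by rewrite -[RHS](JS i'); apply: eq_bigr => j _; rewrite /G i'i mulr1.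
have dev i : \sum_f w f * `|x (f i) - t i| <= 17 / N%:R.
  by rewrite (wM (fun j => `|x j - t i|)) JE.
have -> : peval (\sum_f F (node f) *: W f) y = \sum_f w f * F (node f).
  rewrite /peval linear_sum /=; apply: eq_bigr => f _.
  by rewrite mevalZ -/(peval _ _) WE mulrC.
have -> : F y = \sum_f w f * F y by rewrite -mulr_suml wS mul1r.
rewrite -sumrB.
apply: (le_trans (ler_norm_sum _ _ _)).
apply: (@le_trans _ _ (\sum_f \sum_i L * rho * (w f * `|x (f i) - t i|))).
  apply: ler_sum => f _; rewrite -mulrBr normrM ger0_norm //.
  apply: (le_trans (ler_wpM2l (w0 f) (FL _ _ (nodeP f) yB))).
  rewrite !mulr_sumr; apply: ler_sum => i _.
  rewrite mxE (_ : y ord0 i = rho * t i); last by rewrite mulrC divfK ?gt_eqF.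
  rewrite -mulrBr normrM (gtr0_norm rho0) le_eqVlt.
  by apply/orP; left; apply/eqP; ring.
rewrite exchange_big /=.
apply: (@le_trans _ _ (\sum_(i < n) L * rho * (17 / N%:R))).
  apply: ler_sum => i _; rewrite -mulr_sumr ler_wpM2l //.
  by rewrite mulr_ge0 // ltW.
rewrite sumr_const card_ord -[_ *+ n]mulr_natr le_eqVlt; apply/orP; left.
by apply/eqP; ring.
Qed.

End Box.

(** * Exact penalization *)

Section Smoothness.
Variables (R : realType) (n : nat).
Implicit Types (p q : {mpoly R[n]}) (x y v : 'rV[R]_n).

Lemma mpoly_ring_ind (P : {mpoly R[n]} -> Prop) :
    (forall c, P (mpolyC n c)) -> (forall i, P (mpolyX R (mnm1 i))) ->
    (forall p q, P p -> P q -> P (p + q)) ->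
    (forall p q, P p -> P q -> P (p * q)) ->
  forall p, P p.
Proof.
move=> PC PX PD PM; apply: mpolyind => [|c a p _ _ Pp]; first by rewrite -(mpolyC0 n).
apply/PD => //; rewrite -mul_mpolyC; apply/PM => //; rewrite mpolyXE_id.
apply: (big_ind P); [exact: (PC 1) | exact: PM | move=> i _].
by elim: (a i) => [|k IH]; [exact: (PC 1) | rewrite exprS; apply/PM].
Qed.

Definition l1norm v : R := \sum_i `|v ord0 i|.

Definition dgrad p x v : R := \sum_i grad p x ord0 i * v ord0 i.

Lemma l1norm_ge0 v : 0 <= l1norm v.
Proof. by apply: sumr_ge0. Qed.

Lemma l1normZ c v : l1norm (c *: v) = `|c| * l1norm v.
Proof. by rewrite /l1norm mulr_sumr; apply: eq_bigr => i _; rewrite mxE normrM. Qed.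

Lemma ler_coord_l1norm v i : `|v ord0 i| <= l1norm v.
Proof. by rewrite /l1norm (bigD1 i) //= lerDl sumr_ge0. Qed.

Lemma pevalD p q x : peval (p + q) x = peval p x + peval q x.
Proof. exact: mevalD. Qed.

Lemma pevalB p q x : peval (p - q) x = peval p x - peval q x.
Proof. exact: mevalB. Qed.

Lemma pevalN p x : peval (- p) x = - peval p x.
Proof. exact: mevalN. Qed.

Lemma pevalZ c p x : peval (c *: p) x = c * peval p x.
Proof. exact: mevalZ. Qed.

Lemma pevalM p q x : peval (p * q) x = peval p x * peval q x.
Proof. exact: mevalM. Qed.

Lemma pevalC c x : peval (mpolyC n c) x = c.
Proof. exact: mevalC. Qed.

Lemma peval_sum (I : Type) (s : seq I) (P : pred I) (F : I -> {mpoly R[n]}) x :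
  peval (\sum_(i <- s | P i) F i) x = \sum_(i <- s | P i) peval (F i) x.
Proof. by rewrite /peval rmorph_sum. Qed.

Lemma dgradE p x v : dgrad p x v = \sum_i peval (mderiv i p) x * v ord0 i.
Proof. by apply: eq_bigr => i _; rewrite mxE. Qed.

Lemma dgradC c x v : dgrad (mpolyC n c) x v = 0.
Proof. by rewrite dgradE big1 // => i _; rewrite mderivC /peval meval0 mul0r. Qed.

Lemma dgradX i x v : dgrad (mpolyX R (mnm1 i)) x v = v ord0 i.
Proof.
rewrite dgradE (bigD1 i) //= big1 ?addr0 => [|j ji].
  rewrite mderivX mnm1E eqxx scale1r (_ : mnm_sub _ _ = mnm0); last first.
    by apply/mnmP => k; rewrite mnmBE mnm0E subnn.
  by rewrite mpolyX0 /peval meval1 mul1r.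
by rewrite mderivX mnm1E eq_sym (negPf ji) scale0r /peval meval0 mul0r.
Qed.

Lemma dgradD p q x v : dgrad (p + q) x v = dgrad p x v + dgrad q x v.
Proof.
by rewrite !dgradE -big_split; apply: eq_bigr => i _; rewrite mderivD pevalD mulrDl.
Qed.

Lemma dgradM p q x v :
  dgrad (p * q) x v = peval p x * dgrad q x v + peval q x * dgrad p x v.
Proof.
rewrite !dgradE !mulr_sumr -big_split; apply: eq_bigr => i _ /=.
by rewrite mderivM pevalD !pevalM; ring.
Qed.

Lemma dgradZ p x c v : dgrad p x (c *: v) = c * dgrad p x v.
Proof. by rewrite !dgradE mulr_sumr; apply: eq_bigr => i _; rewrite mxE mulrCA. Qed.

(** The three bounds are kept together because the Taylor remainder of a product draws on the size
    and the increments of both factors as well as on their remainders. *)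
Definition smooth_on (r C : R) p := forall x y, inbox r x -> inbox r y ->
  [/\ `|peval p x| <= C, `|peval p y - peval p x| <= C * l1norm (y - x) &
      `|peval p y - peval p x - dgrad p x (y - x)| <= C * l1norm (y - x) ^+ 2].

Lemma smooth_on_le r C D p : C <= D -> smooth_on r C p -> smooth_on r D p.
Proof.
move=> CD sp x y xr yr; have [a b c] := sp x y xr yr; split.
- exact: le_trans CD.
- by apply: (le_trans b); rewrite ler_wpM2r // l1norm_ge0.
- by apply: (le_trans c); rewrite ler_wpM2r // sqr_ge0.
Qed.

Lemma smooth_poly r p : exists2 C, 0 <= C & smooth_on r C p.
Proof.
elim/mpoly_ring_ind: p => [c|i|p q [C C0 Cp] [D D0 Dq]|p q [C C0 Cp] [D D0 Dq]].
- exists `|c| => // x y _ _; rewrite !pevalC dgradC subrr subr0 normr0.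
  by split=> //; rewrite mulr_ge0 ?l1norm_ge0 ?sqr_ge0.
- exists (Num.max 1 r); first by rewrite le_max ler01.
  move=> x y xr yr; rewrite dgradX /peval !mevalXU !mxE subrr normr0; split.
  + by rewrite le_max xr orbT.
  + rewrite -[leLHS]mul1r ler_pM // ?le_max ?lexx //.
    by have := ler_coord_l1norm (y - x) i; rewrite !mxE.
  + by rewrite mulr_ge0 ?sqr_ge0 // le_max ler01.
- exists (C + D); first exact: addr_ge0.
  move=> x y xr yr; have [a b c] := Cp x y xr yr; have [a' b' c'] := Dq x y xr yr.
  rewrite !pevalD dgradD !mulrDl; split.
  + by apply: (le_trans (ler_normD _ _)); rewrite lerD.
  + rewrite (_ : _ - _ = peval p y - peval p x + (peval q y - peval q x)); last by ring.
    by apply: (le_trans (ler_normD _ _)); rewrite lerD.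
  + rewrite (_ : _ - _ = peval p y - peval p x - dgrad p x (y - x) +
      (peval q y - peval q x - dgrad q x (y - x))); last by ring.
    by apply: (le_trans (ler_normD _ _)); rewrite lerD.
- exists (3 * (C * D)); first by rewrite !mulr_ge0.
  move=> x y xr yr; have [a b c] := Cp x y xr yr; have [a' b' c'] := Dq x y xr yr.
  have [ay _ _] := Dq y x yr xr.
  have CD0 : 0 <= C * D by rewrite mulr_ge0.
  have h0 := l1norm_ge0 (y - x); set h := l1norm _ in b b' c c' h0 *.
  rewrite !pevalM dgradM; split.
  + rewrite normrM; apply: (@le_trans _ _ (C * D)); first by rewrite ler_pM.
    by rewrite ler_peMl // ler1n.
  + rewrite (_ : _ - _ = peval q y * (peval p y - peval p x) +
      peval p x * (peval q y - peval q x)); last by ring.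
    apply: (le_trans (ler_normD _ _)); rewrite !normrM.
    have h1 : `|peval q y| * `|peval p y - peval p x| <= D * (C * h) by rewrite ler_pM.
    have h2 : `|peval p x| * `|peval q y - peval q x| <= C * (D * h) by rewrite ler_pM.
    have h3 : 0 <= C * D * h by rewrite mulr_ge0.
    by apply: (le_trans (lerD h1 h2)); lra.
  + rewrite (_ : _ - _ - _ = peval p x * (peval q y - peval q x - dgrad q x (y - x)) +
      peval q x * (peval p y - peval p x - dgrad p x (y - x)) +
      (peval p y - peval p x) * (peval q y - peval q x)); last by ring.
    apply: (le_trans (ler_normD _ _)); rewrite !normrM.
    apply: (@le_trans _ _ (C * (D * h ^+ 2) + D * (C * h ^+ 2) + C * h * (D * h))).
      apply: lerD; last by rewrite ler_pM.
      by apply: (le_trans (ler_normD _ _)); rewrite !normrM lerD // ler_pM.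
    by rewrite le_eqVlt; apply/orP; left; apply/eqP; ring.
Qed.

Lemma continuous_peval p : continuous (peval p).
Proof.
elim/mpoly_ring_ind: p => [c|i|p q cp cq|p q cp cq] x.
- rewrite (_ : peval _ = cst c); first exact: cst_continuous.
  by apply/funext => y; exact: pevalC.
- rewrite (_ : peval _ = fun y : 'rV[R]_n => y ord0 i); first exact: coord_continuous.
  by apply/funext => y; rewrite /peval mevalXU.
- rewrite (_ : peval _ = peval p \+ peval q).
    by apply: continuousD; [exact: cp | exact: cq].
  by apply/funext => y; exact: pevalD.
- rewrite (_ : peval _ = peval p \* peval q).
    by apply: continuousM; [exact: cp | exact: cq].
  by apply/funext => y; exact: pevalM.
Qed.

End Smoothness.

(** * Slope of the constraint violation *)

Section Penalty.
Variables (R : realType) (n m : nat) (g : 'I_m -> {mpoly R[n]}).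
Implicit Types (x y v : 'rV[R]_n).

Definition negpart (t : R) : R := Num.max 0 (- t).

Definition viol x : R := \sum_i negpart (peval (g i) x).

Lemma negpart_ge0 t : 0 <= negpart t.
Proof. by rewrite le_max lexx. Qed.

Lemma negpart_le s t : s <= t -> negpart t <= negpart s.
Proof. by rewrite /negpart /Num.max; do 2 case: ifP; lra. Qed.

Lemma negpart_lip (s t : R) : `|negpart s - negpart t| <= `|s - t|.
Proof.
wlog st : s t / s <= t.
  by move=> H; have /orP[/H //|/H h] := le_total s t; rewrite distrC [leRHS]distrC.
rewrite ger0_norm ?subr_ge0 ?negpart_le // ler0_norm ?subr_le0 //.
by rewrite /negpart /Num.max; do 2 case: ifP; lra.
Qed.

Lemma viol_ge0 x : 0 <= viol x.
Proof. by apply: sumr_ge0 => i _; exact: negpart_ge0. Qed.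

Lemma viol_eq0 x : viol x = 0 <-> feasible g x.
Proof.
rewrite (rwP eqP) psumr_eq0 => [|i _]; last exact: negpart_ge0; split=> [/allP vx i|fx].
  have /implyP/(_ isT)/eqP := vx i (mem_index_enum i).
  by rewrite /negpart /Num.max; case: ifP; lra.
by apply/allP => i _; apply/implyP => _; rewrite /negpart max_l // oppr_le0.
Qed.

Lemma viol_infeasible x : 0 < viol x -> exists i, peval (g i) x < 0.
Proof.
move=> vx; have [/existsP//|] := boolP [exists i, peval (g i) x < 0].
rewrite negb_exists => /forallP fx.
suff /viol_eq0 v0 : feasible g x by rewrite v0 ltxx in vx.
by move=> i; rewrite leNgt.
Qed.

Lemma continuous_viol : continuous viol.
Proof.
apply: continuous_big => [|i _ x]; first exact: add_continuous.
apply: (@continuous_max _ _ (cst 0) (fun y => - peval (g i) y)).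
  exact: cst_continuous.
by apply: continuousN; exact: continuous_peval.
Qed.

(** Independent active gradients form the rows of a matrix with a right inverse; applied to the
    all-ones vector, that inverse gives the direction. *)
Lemma CQC_direction x : CQC g -> feasible g x ->
  exists v, forall i, peval (g i) x = 0 -> dgrad (g i) x v = 1.
Proof.
move=> cqc fx; have := cqc x fx.
set s := [seq _ | _ <- _ & _] => /(@freeP _ _ _ (in_tuple s)) fs.
pose A := \matrix_(k < size s, j < n) (s`_k) ord0 j.
have /row_freeP[B AB] : row_free A.
  apply: inj_row_free => u uA; apply/rowP => k; rewrite mxE.
  apply: (fs (fun k => u ord0 k)); apply/rowP => j.
  move/rowP/(_ j): uA; rewrite mxE => uA; rewrite summxE -[RHS]uA.
  by apply: eq_bigr => i _; rewrite !mxE.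
exists (B *m const_mx 1)^T => i gi0.
have si : grad (g i) x \in s.
  by apply: map_f; rewrite mem_filter gi0 eqxx mem_enum.
have ki : (index (grad (g i) x) s < size s)%N by rewrite index_mem.
have : (A *m (B *m const_mx 1 : 'cV[R]_n)) (Ordinal ki) ord0 = 1.
  by rewrite mulmxA AB mul1mx mxE.
rewrite mxE => E; rewrite -[RHS]E; apply: eq_bigr => j _.
by rewrite [A _ _]mxE nth_index // [_^T _ _]mxE.
Qed.

Variable rho : R.
Hypothesis rho0 : 0 < rho.

Lemma inbox_near x : inbox rho x -> \forall y \near x, inbox (3 / 2 * rho) y.
Proof.
move=> xr.
suff H (i : 'I_n) : \forall y \near x, `|(y : 'rV[R]_n) ord0 i| <= 3 / 2 * rho.
  exact: filter_forall H.
near=> y.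
have : `|x ord0 i - y ord0 i| <= rho / 2.
  near: y; have := @coord_continuous R 1 n ord0 i x.
  by move=> /cvgr_dist_le; apply; rewrite divr_gt0.
have := xr i; rewrite !ler_norml => /andP[? ?] /andP[? ?]; apply/andP; split; lra.
Unshelve. all: by end_near. Qed.

Lemma inbox_step x v t : inbox (3 / 2 * rho) x -> 0 <= t ->
  t * l1norm v <= rho / 2 -> inbox (2 * rho) (x + t *: v).
Proof.
move=> xr t0 tv i; rewrite !mxE; apply: (le_trans (ler_normD _ _)).
have := xr i; rewrite normrM ger0_norm // => ?.
have := ler_wpM2l t0 (ler_coord_l1norm v i); lra.
Qed.

(** An active constraint keeps slope at least [3 / 4] near [x] and loses at most [t / 4] to the
    Taylor remainder. An inactive one stays positive under short steps. Choosing [e] before the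
    neighbourhood lets one [e] serve all the constraints. *)
Lemma step_ineq x v i : (peval (g i) x = 0 -> dgrad (g i) x v = 1) ->
    inbox rho x -> feasible g x ->
  \forall e \near 0^'+, \forall y \near x, forall t, 0 < t <= e ->
    0 <= peval (g i) (y + t *: v) \/
    peval (g i) y + t / 2 <= peval (g i) (y + t *: v).
Proof.
move=> gv xr fx; have [C C0 Cg] := smooth_poly (2 * rho) (g i).
have stepK (y : 'rV[R]_n) t : y + t *: v - y = t *: v by rewrite addrC addKr.
pose V := l1norm v; have V0 : 0 <= V by exact: l1norm_ge0.
have D0 : 0 < 4 * (C + 1) * (V + 1) ^+ 2 by rewrite !mulr_gt0 ?exprn_gt0 ?ltr_wpDl.
have step e : 0 < e -> e * V <= rho / 2 -> \forall y \near x, forall t, 0 < t <= e ->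
    inbox (2 * rho) y /\ inbox (2 * rho) (y + t *: v).
  move=> e0 eV; near=> y => t /andP[t0 te].
  have yr : inbox (3 / 2 * rho) y by near: y; exact: inbox_near.
  split.
    move=> j; apply: (le_trans (yr j)).
    by rewrite ler_wpM2r ?ltW // ltr_pdivrMr // -natrM ltr_nat.
  apply: inbox_step => //; first exact: ltW.
  by apply: le_trans eV; rewrite ler_wpM2r.
have [gx|gx] := eqVneq (peval (g i) x) 0.
  near=> e.
  have e0 : 0 < e by near: e; exact: nbhs_right_gt.
  have eV : e * V <= rho / 2.
    apply: (@le_trans _ _ (e * (V + 1))); first by rewrite (ler_wpM2l (ltW e0)) // lerDl.
    rewrite -ler_pdivlMr ?ltr_wpDl //; near: e; apply: nbhs_right_le.
    by rewrite !divr_gt0 // ltr_wpDl.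
  have eC : e * (4 * (C + 1) * (V + 1) ^+ 2) <= 1.
    rewrite -ler_pdivlMr //; near: e; apply: nbhs_right_le.
    by rewrite divr_gt0.
  near=> y => t te; right.
  have [yr yr'] : inbox (2 * rho) y /\ inbox (2 * rho) (y + t *: v).
    by move: t te; near: y; exact: step.
  have dy : 3 / 4 <= dgrad (g i) y v.
    near: y; have : {for x, continuous (fun y => dgrad (g i) y v)}.
      rewrite (_ : (fun _ => _) = fun y => \sum_j peval (mderiv j (g i)) y * v ord0 j).
        apply: continuous_big => [|j _ y]; first exact: add_continuous.
        apply: (@continuousM _ _ (peval _) (cst _)); first exact: continuous_peval.
        exact: cst_continuous.
      by apply/funext => y; exact: dgradE.
    move=> /cvgr_ge; apply; rewrite gv //.
    by rewrite ltr_pdivrMr // mul1r ltr_nat.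
  have [_ _] := Cg y _ yr yr'; rewrite stepK dgradZ l1normZ -/V.
  move: te => /andP[t0 te]; rewrite (gtr0_norm t0) ler_norml => /andP[h _].
  have tC : t * (C * V ^+ 2) <= 1 / 4.
    have tC : t * (4 * (C + 1) * (V + 1) ^+ 2) <= 1.
      by apply: le_trans eC; rewrite ler_wpM2r // ltW.
    have : t * (C * V ^+ 2) <= t * ((C + 1) * (V + 1) ^+ 2).
      rewrite (ler_wpM2l (ltW t0)) // ler_pM ?sqr_ge0 ?lerDl //.
      by rewrite ler_sqr ?nnegrE ?lerDl // addr_ge0.
    by lra.
  have := ler_wpM2l (ltW t0) tC; have := ler_wpM2l (ltW t0) dy.
  move: h; rewrite exprMn; lra.
have gx0 : 0 < peval (g i) x by rewrite lt_def gx fx.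
have CV : 0 < C * V + 1 by rewrite ltr_wpDl // mulr_ge0.
near=> e.
have e0 : 0 < e by near: e; exact: nbhs_right_gt.
have eV : e * V <= rho / 2.
  apply: (@le_trans _ _ (e * (V + 1))); first by rewrite (ler_wpM2l (ltW e0)) // lerDl.
  rewrite -ler_pdivlMr ?ltr_wpDl //; near: e; apply: nbhs_right_le.
  by rewrite !divr_gt0 // ltr_wpDl.
have eC : e * (C * V + 1) <= peval (g i) x / 2.
  rewrite -ler_pdivlMr //; near: e; apply: nbhs_right_le.
  by rewrite !divr_gt0.
near=> y => t te; left.
have [yr yr'] : inbox (2 * rho) y /\ inbox (2 * rho) (y + t *: v).
  by move: t te; near: y; exact: step.
have gy : peval (g i) x / 2 <= peval (g i) y.
  near: y; move: (continuous_peval (p := g i) (x := x)) => /cvgr_ge; apply.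
  by rewrite ltr_pdivrMr // ltr_pMr // ltr1n.
have [_ + _] := Cg y _ yr yr'; rewrite stepK l1normZ -/V.
move: te => /andP[t0 te]; rewrite (gtr0_norm t0) ler_norml => /andP[h _].
have : t * (C * V + 1) <= e * (C * V + 1).
  by rewrite ler_wpM2r // addr_ge0 // mulr_ge0.
by move: h; rewrite mulrDr mulr1 mulrCA; lra.
Unshelve. all: by end_near. Qed.

(* A step along [v] increases all the active constraints at about unit speed. *)
Lemma slope_near x : CQC g -> inbox rho x -> feasible g x ->
  exists2 k, 0 < k & \forall y \near x, 0 < viol y ->
    exists z, [/\ inbox (2 * rho) z, 0 < l1norm (z - y) &
                  viol z <= viol y - k * l1norm (z - y)].
Proof.
move=> cqc xr fx; have [v gv] := CQC_direction cqc fx.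
have stepK (y : 'rV[R]_n) t : y + t *: v - y = t *: v by rewrite addrC addKr.
pose V := l1norm v; have V0 : 0 <= V by exact: l1norm_ge0.
have V1 : 0 < 2 * (V + 1) by rewrite mulr_gt0 // ltr_wpDl.
have /filter_ex[e [e0 eV He]] : \forall e \near 0^'+, [/\ 0 < e, e * V <= rho / 2 &
    forall i, \forall y \near x, forall t, 0 < t <= e ->
    0 <= peval (g i) (y + t *: v) \/
    peval (g i) y + t / 2 <= peval (g i) (y + t *: v)].
  near=> e; have e0 : 0 < e by near: e; exact: nbhs_right_gt.
  split=> //.
    apply: (@le_trans _ _ (e * (V + 1))); first by rewrite (ler_wpM2l (ltW e0)) // lerDl.
    rewrite -ler_pdivlMr ?ltr_wpDl //; near: e; apply: nbhs_right_le.
    by rewrite !divr_gt0 // ltr_wpDl.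
  near: e; apply: filter_forall => i; apply: step_ineq => //; exact: gv.
(* This converts a decrease of [t / 2] into a multiple of the step length [t * V]; adding one to [V]
   keeps the denominator positive. *)
exists (2 * (V + 1))^-1; first by rewrite invr_gt0.
have {}He := filter_forall _ He; near=> y => vy.
have yr : inbox (3 / 2 * rho) y by near: y; exact: inbox_near.
have Hy : forall i t, 0 < t <= e -> 0 <= peval (g i) (y + t *: v) \/
    peval (g i) y + t / 2 <= peval (g i) (y + t *: v).
  by near: y; exact: He.
have [i gi] := viol_infeasible vy.
(* The step is capped so that [t / 2] does not exceed the violation of constraint [i]; its negative
   part then drops by the full [t / 2]. *)
pose t := Num.min e (- 2 * peval (g i) y).
have t0 : 0 < t by rewrite lt_min e0 /= mulNr oppr_gt0 pmulr_rlt0.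
have te : t <= e by rewrite ge_min lexx.
have tg : t / 2 <= - peval (g i) y.
  have : t <= - 2 * peval (g i) y by rewrite ge_min lexx orbT.
  by rewrite ler_pdivrMr // mulrC mulrN mulNr.
have mono j : negpart (peval (g j) (y + t *: v)) <= negpart (peval (g j) y).
  have /(Hy j)[h|h] : 0 < t <= e by rewrite t0.
    by rewrite [leLHS]/negpart max_l ?negpart_ge0 // oppr_le0.
  by apply: negpart_le; lra.
have tV : t * V <= rho / 2 by apply: le_trans eV; rewrite ler_wpM2r.
(* A zero direction would leave [y] fixed, against the gain at the violated constraint. *)
have Vpos : 0 < V.
  rewrite lt_neqAle V0 andbT eq_sym; apply/eqP => Vz.
  have vz : v = 0.
    apply/rowP => j; apply/eqP; rewrite mxE -normr_le0 -Vz.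
    exact: ler_coord_l1norm.
  have /(Hy i) : 0 < t <= e by rewrite t0.
  by rewrite vz scaler0 addr0; case; lra.
exists (y + t *: v); rewrite stepK l1normZ (gtr0_norm t0) -/V; split.
- by apply: inbox_step => //; exact: ltW.
- exact: mulr_gt0.
have ktV : (2 * (V + 1))^-1 * (t * V) <= t / 2.
  rewrite mulrC ler_pdivrMr // (_ : t / 2 * _ = t * V + t); last by field.
  by rewrite lerDl ltW.
have gd : negpart (peval (g i) (y + t *: v)) <= negpart (peval (g i) y) - t / 2.
  rewrite [X in _ <= X - _]max_r; last by lra.
  have /(Hy i)[h|h] : 0 < t <= e by rewrite t0.
    by rewrite /negpart max_l ?oppr_le0 //; lra.
  apply: (le_trans (negpart_le h)); rewrite /negpart max_r //; lra.
rewrite /viol (bigD1 i) //= [X in _ <= X - _](bigD1 i) //=.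
have : \sum_(j | j != i) negpart (peval (g j) (y + t *: v)) <=
       \sum_(j | j != i) negpart (peval (g j) y) by apply: ler_sum.
by move: gd ktV; lra.
Unshelve. all: by end_near. Qed.

Lemma compact_inbox (r : R) : compact [set x : 'rV[R]_n | inbox r x].
Proof.
have := @rV_compact R n (fun=> `[(- r), r]%classic) (fun=> @segment_compact _ _ _).
congr compact; apply/seteqP; split=> x /= xr i; have := xr i.
  by rewrite in_itv /= -ler_norml.
by rewrite in_itv /= -ler_norml.
Qed.

(** Compactness of the box makes one [k] work everywhere: near a feasible point [slope_near]
    applies, and near any other point the violation is bounded below. Both persist for smaller
    [k]. *)
Lemma slope_uniform : CQC g -> (forall x, feasible g x -> inbox rho x) ->
  exists2 k, 0 < k & forall y, inbox (2 * rho) y ->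
    [\/ viol y = 0, k <= viol y |
     exists z, [/\ inbox (2 * rho) z, 0 < l1norm (z - y) &
                  viol z <= viol y - k * l1norm (z - y)]].
Proof.
move=> cqc Xr.
pose P (k : R) y := [\/ viol y = 0, k <= viol y |
     exists z, [/\ inbox (2 * rho) z, 0 < l1norm (z - y) &
                  viol z <= viol y - k * l1norm (z - y)]].
have cov := (compact_near_coveringP _).1 (@compact_inbox (2 * rho)).
have {}cov : \forall k \near 0^'+, [set x | inbox (2 * rho) x] `<=` P k.
  apply: cov => x _; have [/viol_eq0 fx|vx] := eqVneq (viol x) 0.
    have [k k0 kP] := slope_near cqc (Xr x fx) fx.
    near=> y e; rewrite /P /=.
    have [->|vy] := eqVneq (viol y) 0; first exact: Or31.
    have ek : e <= k by near: e; exact: nbhs_right_le.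
    have yP : 0 < viol y -> exists z, [/\ inbox (2 * rho) z, 0 < l1norm (z - y) &
      viol z <= viol y - k * l1norm (z - y)] by near: y; exact: kP.
    have [|z [zr zy vz]] := yP; first by rewrite lt_def vy viol_ge0.
    apply: Or33; exists z; split=> //; apply: (le_trans vz).
    by rewrite lerD2l lerN2 ler_wpM2r // ltW.
  have vx0 : 0 < viol x / 2 by rewrite divr_gt0 // lt_def vx viol_ge0.
  have half : viol x / 2 < viol x by move: vx0; lra.
  near=> y e; apply: Or32.
  have vyx : viol x / 2 <= viol y.
    by near: y; move: (@continuous_viol x) => /cvgr_ge; apply.
  have ev : e <= viol x / 2 by near: e; exact: nbhs_right_le.
  exact: le_trans ev vyx.
have /filter_ex[k [k0 kP]] : \forall k \near 0^'+, 0 < k /\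
    [set x | inbox (2 * rho) x] `<=` P k.
  by near=> k; split; [near: k; exact: nbhs_right_gt | near: k].
by exists k.
Unshelve. all: by end_near. Qed.

(* For large [c], minimizers of [f + c * L * viol] over the box are feasible. *)
Lemma exact_penalty : CQC g -> feasible g !=set0 ->
    (forall x, feasible g x -> inbox rho x) ->
  exists2 c, 0 <= c & forall (f : {mpoly R[n]}) (L : R), 0 < L ->
    (forall x y, inbox (2 * rho) x -> inbox (2 * rho) y ->
       `|peval f x - peval f y| <= L * l1norm (x - y)) ->
    (forall x, feasible g x -> 0 <= peval f x) ->
  forall x, inbox (2 * rho) x -> 0 <= peval f x + c * L * viol x.
Proof.
move=> cqc [x0 fx0] Xr; have [k k0 kP] := slope_uniform cqc Xr.
have x0r : inbox (2 * rho) x0.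
  by move=> i; apply: (le_trans (Xr _ fx0 i)); move: rho0; lra.
(* The [l1norm] diameter of the box is at most [4 * rho * n], so a violation of at least [k]
   outweighs any drop of [f] from a feasible point. The summand 2 makes the descent step strict,
   against minimality. *)
exists ((4 * rho * n%:R + 2) / k).
  by rewrite divr_ge0 ?addr_ge0 ?mulr_ge0 // ltW.
set c := _ / k => f L L0 fL f0.
have ck : c * k = 4 * rho * n%:R + 2 by rewrite /c divfK // gt_eqF.
have [||y yr ymin] := @EVT_min_rV R n (fun x => peval f x + c * L * viol x)
    [set x | inbox (2 * rho) x] _ (@compact_inbox _).
- by exists x0.
- apply: continuous_subspaceT => x; apply: continuousD; first exact: continuous_peval.
  by apply: continuousM; [exact: cst_continuous | exact: continuous_viol].
move=> x xr; apply: le_trans (ymin x _); last by rewrite inE.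
move: yr; rewrite inE /= => yr.
have [vy|vy|[z [zr zy vz]]] := kP y yr.
- by rewrite vy mulr0 addr0; apply/f0/viol_eq0.
- have := fL y x0 yr x0r; rewrite ler_norml => /andP[fy _].
  have := f0 x0 fx0.
  have : l1norm (y - x0) <= 4 * rho * n%:R.
    have -> : 4 * rho * n%:R = \sum_(i < n) 4 * rho.
      by rewrite sumr_const card_ord -[RHS]mulr_natr.
    apply: ler_sum => i _; rewrite !mxE; apply: (le_trans (ler_normB _ _)).
    by have := yr i; have := x0r i; move: rho0; lra.
  move=> /(ler_wpM2l (ltW L0)) l1 fx00.
  have : c * L * k <= c * L * viol y.
    by rewrite ler_wpM2l // mulr_ge0 ?(ltW L0) // divr_ge0 ?addr_ge0 ?mulr_ge0 // ltW.
  rewrite [c * L * k](_ : _ = L * (c * k)); last by ring.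
  by rewrite ck mulrDr; move: fy l1; lra.
- have /ymin : z \in [set x | inbox (2 * rho) x] by rewrite inE.
  have := fL z y zr yr; rewrite ler_norml => /andP[_ fzy] zmin.
  have cL : 0 <= c * L.
    by rewrite mulr_ge0 ?(ltW L0) // divr_ge0 ?addr_ge0 ?mulr_ge0 // ltW.
  have := ler_wpM2l cL vz; rewrite mulrBr.
  rewrite (_ : c * L * (k * _) = L * l1norm (z - y) * (c * k)); last by ring.
  rewrite ck mulrDr.
  have Lz : 0 < L * l1norm (z - y) by exact: mulr_gt0.
  have : 0 <= L * l1norm (z - y) * (4 * rho * n%:R).
    by rewrite mulr_ge0 ?(ltW Lz) ?mulr_ge0 // ltW.
  by move: zmin fzy Lz; lra.
Qed.

End Penalty.

(** * Certified lower bounds *)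

Section BallCertificates.
Variables (R : realType) (n m : nat) (g : 'I_m -> {mpoly R[n]}) (rad : R).
Hypothesis rad0 : 0 < rad.
Let G := with_ball g rad.

Lemma with_ball0 : G ord0 = ball_poly n rad.
Proof. by rewrite /G /with_ball unlift_none. Qed.

Lemma with_ballS i : G (lift ord0 i) = g i.
Proof. by rewrite /G /with_ball liftK. Qed.

Lemma cert_constraint i D : (pdeg (g i) <= D)%N -> cert G D (g i).
Proof.
move=> gD; rewrite -with_ballS; apply: (cert_le _ (cert_gen _ _)).
by rewrite with_ballS /hdeg uphalf_half; have := odd_double_half (pdeg (g i)); lia.
Qed.

(** The ball constraint plus the squares of the other coordinates is [rad ^ 2] minus the square of
    coordinate [i]. *)
Lemma cert_ball_bvar i : cert G 1 (1 - bvar rad i ^+ 2).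
Proof.
have pX j : (pdeg (mpolyX R (mnm1 j) : {mpoly R[n]}) <= 1)%N by rewrite pdegX mdeg1.
have rad2 : rad ^+ 2 != 0 by rewrite expf_neq0 // gt_eqF.
have -> : 1 - bvar rad i ^+ 2 = (rad ^+ 2)^-1 *:
    (ball_poly n rad + \sum_(j | j != i) mpolyX R (mnm1 j) ^+ 2).
  rewrite /bvar exprZn exprVn /ball_poly (bigD1 i) //=.
  rewrite opprD addrA addrNK scalerBr; congr (_ - _).
  by rewrite -mul_mpolyC -mpolyCM mulVf.
apply: certZ; first by rewrite invr_ge0 sqr_ge0.
apply: certD; last by apply: cert_sum => j _; exact: cert_sqr.
rewrite -with_ball0; apply: (cert_le _ (cert_gen _ _)); rewrite with_ball0 /hdeg.
have : (pdeg (ball_poly n rad) <= 2)%N.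
  apply: pdegB_le; first by rewrite pdegC.
  by apply: pdeg_sum_le => j _; apply: (leq_trans (pdegXn_le _ _)); have := pX j; lia.
by case: (pdeg _) => [|[|[|d]]].
Qed.

End BallCertificates.

Lemma horner_alg_comp (R : realType) (n : nat) (u : {mpoly R[n]}) (p q : {poly R}) :
  horner_alg u (p \Po q) = horner_alg (horner_alg u q) p.
Proof.
rewrite comp_polyE -[in RHS](coefK p) poly_def !linear_sum /=.
apply: eq_bigr => i _; rewrite !linearZ /= !mulr_algl !rmorphXn /=.
by rewrite horner_algX.
Qed.

Lemma common_bound (R : realType) (I : finType) (P : I -> R -> Prop) :
    (forall i C D, C <= D -> P i C -> P i D) ->
    (forall i, exists2 C, 0 <= C & P i C) ->
  exists2 C, 1 <= C & forall i, P i C.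
Proof.
move=> Pmono PC.
have [C C0 CP] : exists2 C : I -> R, forall i, 0 <= C i & forall i, P i (C i).
  have /choice[C CP] : forall i, exists C, 0 <= C /\ P i C.
    by move=> i; have [C] := PC i; exists C.
  by exists C => i; have [] := CP i.
exists (1 + \sum_i C i) => [|i]; first by rewrite lerDl sumr_ge0.
by apply: Pmono (CP i); rewrite (bigD1 i) //= addrCA lerDl addr_ge0 ?sumr_ge0.
Qed.

Lemma divn_scale (E r : nat) : (0 < E <= r)%N ->
  exists2 N, (0 < N)%N & (E * N <= r)%N /\ (r <= 2 * E * N)%N.
Proof.
move=> /andP[E0 Er]; have N0 : (0 < r %/ E)%N by rewrite divn_gt0.
exists (r %/ E)%N => //; have := divn_eq r E; have := ltn_pmod r E0.
have := leq_pmull E N0; rewrite -mulnA [(E * _)%N]mulnC.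
by move: (_ * E)%N (_ %% _)%N => a b; lia.
Qed.

(** The constant [E] adds up the orders, per unit of [N], of the three certificates in
    [cert_lower_bound]: for [P - K], for [K], and for the approximated negative parts. *)
Lemma degree_budget (n D k N : nat) (E := (2 * n * (2 * (D + n) + k) + n +
    4 * (D + n * (2 * D)))%N) : (0 < N)%N ->
  [/\ (n * (2 * (2 * (D + n) * N + k)) <= E * N)%N, (n * N <= E * N)%N &
      ((D + n * (2 * D)) * (2 * (2 * N)) <= E * N)%N].
Proof.
move=> N0; rewrite {}/E; have kN := leq_pmulr k N0.
have nkN : (n * k <= n * (k * N))%N by rewrite leq_mul.
by split; nia.
Qed.

Section LowerBounds.
Variables (R : realType) (n m : nat) (g : 'I_m -> {mpoly R[n]}) (rad : R).
Hypothesis rad_gt0 : 0 < rad.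
Hypothesis X_nonempty : feasible g !=set0.
Hypothesis X_inbox : forall x, feasible g x -> inbox rad x.
Hypothesis X_CQC : CQC g.
Let G := with_ball g rad.

(* [horner_alg u q] with [q] close to [negpart] is small where [g i >= 0]; the
   substitution [s = 2 u - 1] makes this a bound on [-1, 1]. *)
Lemma cert_negpart i D N (Ga c : R) (q : {poly R}) : (0 < N)%N -> 0 < Ga ->
    (pdeg (g i) <= D)%N -> cert G (n * (2 * D)) (mpolyC n Ga - g i) ->
    (size q <= N.+1)%N -> (forall t, 0 <= t <= 1 -> `|q.[t]| <= c) ->
  cert G ((D + n * (2 * D)) * (2 * N))
    (mpolyC n (3 * c) - horner_alg (Ga^-1 *: g i) q).
Proof.
move=> N0 Ga0 gD cG sq qc; set u := Ga^-1 *: g i.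
pose s : {poly R} := 2^-1 *: ('X + 1).
have sE t : s.[t] = (t + 1) / 2 by rewrite !hornerE mulrC.
have -> : horner_alg u q = horner_alg (2 *: u - 1) (q \Po s).
  rewrite horner_alg_comp; congr (horner_alg _ q).
  rewrite linearZ /= rmorphD /= horner_algX rmorph1 mulr_algl addrNK scalerA.
  by rewrite mulVf ?scale1r // pnatr_eq0.
rewrite addrC -rmorphN; apply: cert_univ => //.
- apply: (@leq_trans D); last by lia.
  apply: pdegB_le; last by rewrite pdeg1.
  by do 2 (apply: (leq_trans (pdegZ_le _ _))).
(* This is [4 u (1 - u)], a product of two certified factors. *)
- have -> : 1 - (2 *: u - 1) ^+ 2 = (4 / Ga ^+ 2) *: (g i * (mpolyC n Ga - g i)).
    have gu : g i = Ga *: u by rewrite scalerA mulfV ?scale1r // gt_eqF.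
    clearbody u; have -> : mpolyC n Ga - g i = Ga *: (1 - u).
      by rewrite gu scalerBr -[mpolyC n Ga]mulr1 mul_mpolyC.
    rewrite gu -scalerAl -scalerAr !scalerA.
    rewrite (_ : 4 / Ga ^+ 2 * Ga * Ga = 4%:R); last by field; rewrite gt_eqF.
    by rewrite !scaler_nat; ring.
  apply: certZ; first by rewrite divr_ge0 ?sqr_ge0.
  by apply: certM => //; exact: cert_constraint.
- rewrite size_polyN size_comp_poly2 // size_scale ?invr_eq0 ?pnatr_eq0 //.
  by rewrite -polyC1 size_XaddC.
move=> t; rewrite ler_norml => /andP[t1 t2].
by rewrite hornerN normrN horner_comp sE; apply: qc; lra.
Qed.

Theorem cert_lower_bound k : exists2 C, 0 <= C & exists r0,
  forall (f : {mpoly R[n]}) (L b : R) r, (pdeg f <= k)%N -> 0 < L ->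
    (forall x y, inbox (2 * rad) x -> inbox (2 * rad) y ->
       `|peval f x - peval f y| <= L * l1norm (x - y)) ->
    (forall x, feasible g x -> b <= peval f x) ->
    (r0 <= r)%N -> cert G r (f - mpolyC n b + mpolyC n (C * L / r%:R)).
Proof.
have [c c0 penalty] := exact_penalty rad_gt0 X_CQC X_nonempty X_inbox.
have box2 (x : 'rV[R]_n) : inbox rad x -> inbox (2 * rad) x.
  by move=> xr i; apply: (le_trans (xr i)); move: rad_gt0; lra.
have [B B1 gB] : exists2 B : R, 1 <= B & forall i, smooth_on (2 * rad) B (g i).
  apply: common_bound => [i C D|i]; first exact: smooth_on_le.
  exact: smooth_poly.
have B0 : 0 < B by rewrite (lt_le_trans ltr01).
(* The successor keeps [D] positive, as [cert_box] asks of its order. *)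
pose D := (\max_i pdeg (g i)).+1.
have gD i : (pdeg (g i) <= D)%N by rewrite leqW // leq_bigmax.
(* The constant that [cert_box] yields from the bound [B]; it also scales each [g i] into [[-1, 1]]
   on the box. *)
pose Ga := 3 ^+ n * B.
have BGa : B <= Ga by rewrite ler_peMl ?(ltW B0) // exprn_ege1 // ler1n.
have Ga0 : 0 < Ga by rewrite (lt_le_trans B0).
have cGa i : cert G (n * (2 * D)) (mpolyC n Ga - g i).
  rewrite addrC; apply: (cert_box rad_gt0 (cert_ball_bvar g rad_gt0)) => // [|x xr].
    by rewrite pdegN.
  by rewrite pevalN normrN; have [] := gB i x x (box2 x xr) (box2 x xr).
pose E := (2 * n * (2 * (D + n) + k) + n + 4 * (D + n * (2 * D)))%N.
have E0 : (0 < E)%N by rewrite /E /D; lia.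
(* In units of [L], [LF] is a Lipschitz constant of [F]. In units of [L / N], [C1] collects the
   errors of [P] and [K] against [F], and [C2] the certified constants, with [51 = 3 * 17]. *)
pose LF := 1 + c * m%:R * B.
have LF0 : 0 <= LF by rewrite addr_ge0 // !mulr_ge0 // ltW.
pose C1 := c * m%:R * (Ga * 17) + LF * (17 * n%:R * rad).
have C10 : 0 <= C1 by rewrite addr_ge0 // !mulr_ge0 // ltW.
pose C2 := 3 ^+ n * C1 + c * m%:R * Ga * 51.
have C20 : 0 <= C2 by rewrite addr_ge0 // !mulr_ge0 ?exprn_ge0 // ltW.
exists (2 * E%:R * C2); first by rewrite !mulr_ge0.
exists E => f L b r fk L0 fL fb Er.
have [N N0 [EN rN]] : exists2 N, (0 < N)%N & (E * N <= r)%N /\ (r <= 2 * E * N)%N.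
  by apply: divn_scale; rewrite E0.
have r0 : (0 < r)%N by exact: leq_trans Er.
have [bPK bK bQ] := degree_budget n D k N0.
have NR : 0 < N%:R :> R by rewrite ltr0n.
have [q [sq qE]] := jackson_approx N0 (@negpart_lip R).
(* As [r <= 2 * E * N], the constant in terms of [r] exceeds this one by a nonnegative amount,
   itself a certificate. *)
suff main : cert G (E * N) (f - mpolyC n b + mpolyC n (C2 * L / N%:R)).
  rewrite (_ : mpolyC n (2 * E%:R * C2 * L / r%:R) = mpolyC n (C2 * L / N%:R) +
      mpolyC n (2 * E%:R * C2 * L / r%:R - C2 * L / N%:R)); last first.
    by rewrite -mpolyCD addrC subrK.
  rewrite addrA; apply: certD; first exact: cert_le main.
  apply: cert_const.
  rewrite (_ : _ - _ = C2 * L * (2 * E%:R / r%:R - N%:R^-1)); last by ring.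
  rewrite mulr_ge0 ?(mulr_ge0 C20) ?(ltW L0) // subr_ge0 ler_pdivlMr ?ltr0n //.
  by rewrite mulrC ler_pdivrMr // -!natrM ler_nat.
pose u i := Ga^-1 *: g i.
pose Q i := Ga *: horner_alg (u i) q.
pose P := f - mpolyC n b + (c * L) *: \sum_i Q i.
pose F x := peval f x - b + c * L * viol g x.
have cL0 : 0 <= c * L by rewrite mulr_ge0 // ltW.
have F0 x : inbox rad x -> 0 <= F x.
  move=> xr; rewrite /F -[b](pevalC (n := n) _ x) -pevalB; apply: penalty => //.
  - by move=> y z yr zr; rewrite !pevalB !pevalC opprB addrA subrK; apply: fL.
  - by move=> y fy; rewrite pevalB pevalC subr_ge0 fb.
  - exact: box2.
have FL x y : inbox rad x -> inbox rad y ->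
    `|F x - F y| <= L * LF * \sum_i `|x ord0 i - y ord0 i|.
  move=> /box2 xr /box2 yr.
  have -> : \sum_i `|x ord0 i - y ord0 i| = l1norm (x - y).
    by apply: eq_bigr => i _; rewrite !mxE.
  have violL : `|viol g x - viol g y| <= m%:R * (B * l1norm (x - y)).
    rewrite /viol -sumrB; apply: (le_trans (ler_norm_sum _ _ _)).
    have -> : m%:R * (B * l1norm (x - y)) = \sum_(i < m) B * l1norm (x - y).
      by rewrite sumr_const card_ord mulr_natl.
    apply: ler_sum => i _; apply: (le_trans (negpart_lip _ _)).
    by have [] := gB i y x yr xr.
  rewrite /F (_ : _ - _ = peval f x - peval f y +
    c * L * (viol g x - viol g y)); last by ring.
  apply: (le_trans (ler_normD _ _)); rewrite normrM (ger0_norm cL0).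
  apply: (le_trans (lerD (fL x y xr yr) (ler_wpM2l cL0 violL))).
  by rewrite le_eqVlt; apply/orP; left; apply/eqP; rewrite /LF; ring.
have PF x : inbox rad x -> `|peval P x - F x| <= L * (c * m%:R * (Ga * 17)) / N%:R.
  move=> xr; have QE i : `|peval (Q i) x - negpart (peval (g i) x)| <= Ga * 17 / N%:R.
    have -> : negpart (peval (g i) x) = Ga * negpart (peval (g i) x / Ga).
      rewrite /negpart maxr_pMr ?(ltW Ga0) // mulr0 mulrN mulrC divfK //.
      by rewrite gt_eqF.
    rewrite /Q pevalZ -mulrBr normrM (gtr0_norm Ga0) -mulrA ler_wpM2l ?(ltW Ga0) //.
    rewrite peval_horner_alg /u pevalZ mulrC; apply: qE.
    rewrite normrM normfV (gtr0_norm Ga0) ler_pdivrMr // mul1r.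
    by apply: le_trans BGa; have [] := gB i x x (box2 x xr) (box2 x xr).
  rewrite /P /F pevalD pevalB pevalC pevalZ peval_sum.
  rewrite (_ : _ - _ = c * L * (\sum_i peval (Q i) x - viol g x)); last by ring.
  rewrite normrM (ger0_norm cL0) /viol -sumrB.
  apply: (@le_trans _ _ (c * L * \sum_(i < m) Ga * 17 / N%:R)).
    rewrite ler_wpM2l //; apply: (le_trans (ler_norm_sum _ _ _)).
    by apply: ler_sum => i _; exact: QE.
  rewrite sumr_const card_ord -[X in _ * X]mulr_natl.
  by rewrite le_eqVlt; apply/orP; left; apply/eqP; ring.
have LLF : 0 <= L * LF by rewrite mulr_ge0 // ltW.
have [K [cK KF]] := box_jackson rad_gt0 (cert_ball_bvar g rad_gt0) N0 LLF F0 FL.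
have PK : cert G (n * (2 * (2 * (D + n) * N + k)))
    (P - K + mpolyC n (3 ^+ n * (L * C1 / N%:R))).
  apply: (cert_box rad_gt0 (cert_ball_bvar g rad_gt0)) => [||x xr].
  - by rewrite addn_gt0 !muln_gt0 addn_gt0 N0.
  - apply: pdegB_le; last first.
      apply: (leq_trans (cert_pdeg cK)); apply: leq_trans (leq_addr _ _).
      by rewrite mulnA leq_mul2r leq_mul2l leq_addl !orbT.
    apply: pdegD_le; first by apply: pdegB_le; rewrite ?pdegC // (leq_trans fk) ?leq_addl.
    apply: (leq_trans (pdegZ_le _ _)); apply: pdeg_sum_le => i _.
    apply: (leq_trans (pdegZ_le _ _)); apply: (leq_trans (pdeg_horner_alg _ _)).
    have : (pdeg (u i) <= D)%N by apply: (leq_trans (pdegZ_le _ _)).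
    move=> uD; apply: (leq_trans (leq_mul uD (_ : _ <= 2 * N)%N)).
      by rewrite -subn1 leq_subLR add1n.
    apply: leq_trans (leq_addr _ _).
    by rewrite mulnA leq_mul2r mulnC leq_mul2l leq_addr !orbT.
  - rewrite pevalB (_ : _ - _ = peval P x - F x - (peval K x - F x)); last by ring.
    apply: (le_trans (ler_normB _ _)); apply: (le_trans (lerD (PF x xr) (KF x xr))).
    by rewrite le_eqVlt; apply/orP; left; apply/eqP; rewrite /C1; ring.
have cQ : cert G (E * N)
    (mpolyC n (c * L * m%:R * Ga * (3 * (17 / N%:R))) - (c * L) *: \sum_i Q i).
  have -> : mpolyC n (c * L * m%:R * Ga * (3 * (17 / N%:R))) - (c * L) *: \sum_i Q i =
      (c * L * Ga) *: \sum_i (mpolyC n (3 * (17 / N%:R)) - horner_alg (u i) q).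
    rewrite sumrB sumr_const card_ord scalerBr -[in LHS]scaler_sumr scalerA.
    congr (_ - _); rewrite -raddfMn -mul_mpolyC -mpolyCM.
    by congr mpolyC; rewrite -[_ *+ m]mulr_natr; ring.
  apply: certZ; first by rewrite mulr_ge0 // ltW.
  apply: cert_sum => i _; apply: (cert_le bQ).
  apply: cert_negpart => //; first by rewrite muln_gt0.
  move=> t /andP[t0 t1]; have t1' : `|t| <= 1 by rewrite ger0_norm.
  by have := qE t t1'; rewrite [negpart t]max_l ?oppr_le0 // subr0.
rewrite (_ : f - mpolyC n b + mpolyC n (C2 * L / N%:R) =
  (P - K + mpolyC n (3 ^+ n * (L * C1 / N%:R))) + K +
  (mpolyC n (c * L * m%:R * Ga * (3 * (17 / N%:R))) - (c * L) *: \sum_i Q i)); last first.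
  have -> : C2 * L / N%:R =
      3 ^+ n * (L * C1 / N%:R) + c * L * m%:R * Ga * (3 * (17 / N%:R)).
    by rewrite /C2; ring.
  by rewrite mpolyCD /P; ring.
apply: certD => //; apply: certD.
  exact: cert_le PK.
exact: cert_le cK.
Qed.

End LowerBounds.

(** * Moment functionals *)

Section MomentFunctionals.
Variables (R : realType) (n l : nat) (g : 'I_l -> {mpoly R[n]}).
Implicit Types (p q : {mpoly R[n]}) (x : 'rV[R]_n).

Lemma mpoly_mexpE d p : (pdeg p <= d)%N ->
  p = \sum_(a : mexp n d) mcoeff a p *: mpolyX R a.
Proof. by move=> pd; apply: mpolywE; move: pd; rewrite /pdeg; lia. Qed.

Lemma rieszD d (y : {ffun mexp n d -> R}) p q : riesz y (p + q) = riesz y p + riesz y q.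
Proof.
by rewrite /riesz -big_split; apply: eq_bigr => a _; rewrite mcoeffD mulrDl.
Qed.

Lemma rieszZ d (y : {ffun mexp n d -> R}) c p : riesz y (c *: p) = c * riesz y p.
Proof.
by rewrite /riesz mulr_sumr; apply: eq_bigr => a _; rewrite mcoeffZ mulrA.
Qed.

Lemma riesz_sum d (y : {ffun mexp n d -> R}) (I : finType) (F : I -> {mpoly R[n]}) :
  riesz y (\sum_i F i) = \sum_i riesz y (F i).
Proof.
apply: (big_ind2 (fun p s => riesz y p = s)) => // [|p s q t <- <-].
  by rewrite /riesz big1 // => a _; rewrite mcoeff0 mul0r.
by rewrite rieszD.
Qed.

Lemma rieszC d (y : {ffun mexp n d -> R}) c : riesz y (mpolyC n c) = c * y bm0.
Proof.
rewrite /riesz (bigD1 bm0) //= big1 => [|a a0]; rewrite mcoeffC.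
  by rewrite eqxx mulr1 addr0.
by rewrite (_ : (_ == _) = false) ?mulr0 ?mul0r //; apply: negbTE.
Qed.

(** On each term, [riesz y] is the quadratic form of a localizing matrix at the coefficient vector
    of [q]. *)
Lemma riesz_cert_ge0 r (y : {ffun mexp n (2 * r) -> R}) p :
  moment_preordering g y -> cert g r p -> 0 <= riesz y p.
Proof.
move=> [y0 _ yg]; elim=> [|q J v qJ _ IH].
  by rewrite -(mpolyC0 n) rieszC mul0r.
rewrite rieszD addr_ge0 //.
have Jr : (hdeg (gprod g J) <= r)%N by lia.
have [_ /(_ (fun a => mcoeff a q))] := yg J Jr.
have qE := @mpoly_mexpE (r - hdeg (gprod g J)) q _.
suff -> : riesz y (q ^+ 2 * gprod g J) =
    \sum_(a : mexp n (r - hdeg (gprod g J))) \sum_(b : mexp n (r - hdeg (gprod g J)))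
      mcoeff a q * loc_matrix (gprod g J) y a b * mcoeff b q by [].
rewrite [in LHS]qE ?expr2; last by lia.
rewrite !mulr_suml riesz_sum; apply: eq_bigr => a _.
rewrite mulr_sumr mulr_suml riesz_sum; apply: eq_bigr => b _.
rewrite /loc_matrix mpolyXD -mulrA [_ * mcoeff b q]mulrC -!rieszZ; congr riesz.
by rewrite -!mul_mpolyC; ring.
Qed.

Definition dirac_moments d x : {ffun mexp n d -> R} :=
  [ffun a : mexp n d => peval (mpolyX R a) x].

Lemma riesz_dirac d x p : (pdeg p <= d)%N -> riesz (dirac_moments d x) p = peval p x.
Proof.
move=> pd; rewrite [in RHS](mpoly_mexpE pd) peval_sum; apply: eq_bigr => a _.
by rewrite ffunE pevalZ.
Qed.

(** For a point mass each localizing matrix is a nonnegative multiple of the rank-one matrix of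
    monomial values. *)
Lemma dirac_moment_preordering r x : (forall j, 0 <= peval (g j) x) ->
  moment_preordering g (dirac_moments (2 * r) x).
Proof.
move=> gx; have H q t : (pdeg q + 2 * t <= 2 * r)%N -> 0 <= peval q x ->
    psd (loc_matrix (t := t) q (dirac_moments (2 * r) x)).
  move=> qt qx; pose h (a : mexp n t) := peval (mpolyX R a) x.
  have ME a b : loc_matrix q (dirac_moments (2 * r) x) a b = peval q x * (h a * h b).
    rewrite /loc_matrix riesz_dirac; first by rewrite pevalM mpolyXD pevalM.
    have := pdegM_le q (mpolyX R (mnm_add a b)); rewrite pdegX mdegD.
    by have := bmdeg a; have := bmdeg b; lia.
  split=> [a b|c]; first by rewrite !ME [h a * _]mulrC.
  under eq_bigr => a _ do under eq_bigr => b _ do rewrite ME.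
  clearbody h; suff -> : \sum_a \sum_b c a * (peval q x * (h a * h b)) * c b =
      peval q x * (\sum_a c a * h a) ^+ 2 by rewrite mulr_ge0 ?sqr_ge0.
  rewrite expr2 mulr_suml mulr_sumr; apply: eq_bigr => a _.
  by rewrite !mulr_sumr; apply: eq_bigr => b _; ring.
split=> [||J Jr].
- by rewrite ffunE mpolyX0 /peval meval1.
- by apply: H; [rewrite pdeg1 | rewrite /peval meval1].
apply: H; last by rewrite /gprod /peval rmorph_prod /=; apply: prodr_ge0 => j _; exact: gx.
move: Jr; rewrite /hdeg uphalf_half.
by have := odd_double_half (pdeg (gprod g J)); lia.
Qed.

End MomentFunctionals.

Section Bounds.
Variables (R : realType) (n m : nat) (g : 'I_m -> {mpoly R[n]}) (rad : R).
Implicit Types (p q f : {mpoly R[n]}) (x : 'rV[R]_n).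
Hypothesis rad0 : 0 <= rad.
Hypothesis X_ball : forall x, feasible g x -> enorm x <= rad.
Let G := with_ball g rad.

Lemma ball_sumsqr x : feasible g x -> \sum_i x ord0 i ^+ 2 <= rad ^+ 2.
Proof.
move=> /X_ball xr.
rewrite -[leLHS]sqr_sqrtr; last by apply: sumr_ge0 => i _; exact: sqr_ge0.
by rewrite ler_sqr ?nnegrE ?sqrtr_ge0.
Qed.

Lemma feasible_inbox x : feasible g x -> inbox rad x.
Proof.
move=> fx i; rewrite -ler_sqr ?nnegrE // -normrX ger0_norm ?sqr_ge0 //.
apply: le_trans (ball_sumsqr fx).
by rewrite (bigD1 i) //= lerDl; apply: sumr_ge0 => j _; exact: sqr_ge0.
Qed.

Lemma feasible_with_ball x : feasible g x -> forall j, 0 <= peval (G j) x.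
Proof.
move=> fx j; rewrite /G /with_ball; case: unliftP => [i _|_]; first exact: fx.
rewrite /ball_poly pevalB pevalC peval_sum subr_ge0.
apply: le_trans (ball_sumsqr fx); rewrite le_eqVlt; apply/orP; left; apply/eqP.
by apply: eq_bigr => i _; rewrite /peval rmorphXn /= mevalXU.
Qed.

Local Open Scope ereal_scope.

Lemma abs_sub_le (a c : R) (u : \bar R) :
  (a - c)%:E <= u -> u <= a%:E -> `|a%:E - u| <= c%:E.
Proof.
case: u => [u| |] //; rewrite !lee_fin => h1 h2.
by rewrite ger0_norm ?subr_ge0 //; lra.
Qed.

Lemma bigO_inv_lower (a C : R) (r0 : nat) (u : nat -> \bar R) :
  (forall r, (r0 <= r)%N -> (a - C / r%:R)%:E <= u r <= a%:E) ->
  bigO_inv (fun r => a%:E - u r).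
Proof.
move=> H; exists C; near=> r.
have /H/andP[h1 h2] : (r0 <= r)%N by near: r; exact: nbhs_infty_ge.
exact: abs_sub_le.
Unshelve. all: by end_near. Qed.

Lemma lb_le f x r : feasible g x -> lb f (preordering G) r <= (peval f x)%:E.
Proof.
move=> fx; apply: ge_ereal_sup => _ [a /= fa <-]; rewrite lee_fin.
have := peval_preordering (feasible_with_ball fx) fa.
by rewrite pevalB pevalC subr_ge0.
Qed.

Lemma mlb_le f x r : feasible g x -> (pdeg f <= 2 * r)%N ->
  mlb f (moment_preordering G) r <= (peval f x)%:E.
Proof.
move=> fx fr; apply: ereal_inf_lbound; exists (dirac_moments (2 * r) x).
  exact/dirac_moment_preordering/feasible_with_ball.
by rewrite riesz_dirac.
Qed.

Lemma le_lb f a r : cert G r (f - mpolyC n a)%R -> a%:E <= lb f (preordering G) r.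
Proof. by move=> fa; apply: ereal_sup_ubound; exists a => //; exact: cert_preordering. Qed.

Lemma le_mlb f a r : cert G r (f - mpolyC n a)%R -> a%:E <= mlb f (moment_preordering G) r.
Proof.
move=> fa; apply: le_ereal_inf_tmp => _ [y yM <-]; rewrite lee_fin.
have := riesz_cert_ge0 yM fa; have [y0 _ _] := yM.
by rewrite rieszD -(scaleN1r (mpolyC n a)) rieszZ rieszC y0; lra.
Qed.

End Bounds.

(** * Convex combinations of Dirac moments *)

Section Mixtures.
Context d (T : measurableType d) (R : realType).
Local Open Scope ereal_scope.

Lemma integral_mscale (mu : {measure set T -> \bar R}) (D : set T) (k : {nonneg R})
    (f : T -> \bar R) : measurable D -> mu.-integrable D f ->
  \int[mscale k mu]_(x in D) f x = k%:num%:E * \int[mu]_(x in D) f x.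
Proof.
move=> mD fint; have mf := measurable_int mu fint.
rewrite [LHS]integralE [X in _ = _ * X]integralE.
rewrite (ge0_integral_mscale _ mD _ (measurable_funepos mf)) //.
rewrite (ge0_integral_mscale _ mD _ (measurable_funeneg mf)) //.
by rewrite [RHS]muleBr // fin_num_adde_defl // fin_numN integrable_neg_fin_num.
Qed.

(** A bounded measurable function is integrable for every finite measure, which allows the integral
    to be split. *)
Lemma probability_mix (mu nu : probability T R) (t : R) : (0 <= t <= 1)%R ->
  exists P : probability T R,
    (forall A, P A = (1 - t)%:E * mu A + t%:E * nu A) /\
    forall (D : set T) (f : T -> R) (M : R), measurable D -> measurable_fun D f ->
      (forall x, D x -> (`|f x| <= M)%R) ->
      \int[P]_(x in D) (f x)%:E =
        (1 - t)%:E * \int[mu]_(x in D) (f x)%:E + t%:E * \int[nu]_(x in D) (f x)%:E.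
Proof.
move=> /andP[t0 t1]; have t1' : (0 <= 1 - t)%R by rewrite subr_ge0.
pose m1 := mscale (NngNum t1') mu; pose m2 := mscale (NngNum t0) nu.
pose m : {measure set T -> \bar R} := measure_add m1 m2.
have mE A : m A = (1 - t)%:E * mu A + t%:E * nu A by exact: measure_addE.
have mT : m setT = 1 by rewrite mE !probability_setT !mule1 -EFinD subrK.
pose P := HB.pack_for (probability T R) (measure_function.Measure.sort m)
  (Measure_isProbability.Build _ _ _ m mT).
exists P; split=> [A|D f M mD mf fM]; first exact: mE.
have fint (Q : {measure set T -> \bar R}) : Q D < +oo -> Q.-integrable D (EFin \o f).
  move=> QD; apply: measurable_bounded_integrable => //.
  by exists M; split; [exact: num_real | move=> N MN x /fM /le_trans; apply; exact: ltW].
have fin (Q : probability T R) : Q D < +oo.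
  by rewrite (le_lt_trans (probability_le1 Q mD)) // ltry.
have fin' (k : {nonneg R}) (Q : probability T R) : mscale k Q D < +oo.
  by rewrite /mscale lte_mul_pinfty // fin.
rewrite (_ : \int[P]_(x in D) _ = \int[measure_add m1 m2]_(x in D) (EFin \o f) x) //.
rewrite (integral_measure_add mD (fint _ (fin' _ _)) (fint _ (fin' _ _))).
by rewrite !integral_mscale //; exact/fint/fin.
Qed.

End Mixtures.

Section BorelMoments.
Variables (R : realType) (n : nat).

Lemma measurable_open_rV (A : set 'rV[R]_n) :
  open A -> @measurable _ (borel_rV R n) A.
Proof. by move=> oA; exact: sub_sigma_algebra. Qed.

Lemma measurable_closed_rV (A : set 'rV[R]_n) :
  closed A -> @measurable _ (borel_rV R n) A.
Proof.
move=> cA; rewrite -[A]setCK; apply: measurableC; apply: measurable_open_rV.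
exact: closed_openC.
Qed.

Lemma measurable_peval (D : set 'rV[R]_n) (p : {mpoly R[n]}) :
  @measurable_fun _ _ (borel_rV R n) R D (peval p).
Proof.
apply: (@measurable_funS _ _ _ _ setT) => //.
apply: (measurability _ (RGenOpens.measurableE R)).
move=> _ [_ [a [b ->] <-]]; rewrite setTI; apply: measurable_open_rV.
apply: open_comp; last exact: interval_open.
by move=> x _; exact: continuous_peval.
Qed.

(* The convex hull is generated by mixing in one point at a time. *)
Inductive mom_hull (X : set 'rV[R]_n) k : {ffun mexp n k -> R} -> Prop :=
| mom_hull_pt x : X x -> mom_hull X (dirac_moments k x)
| mom_hull_mix t x z : 0 <= t <= 1 -> X x -> mom_hull X z ->
    mom_hull X [ffun a => (1 - t) * z a + t * dirac_moments k x a].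

(** Compactness makes [X] Borel and the monomials bounded on it; each step of the hull mixes the
    representing measure with a point mass. *)
Lemma mom_hull_moments X k z : compact X -> mom_hull X z -> @moments_on R n X k z.
Proof.
move=> cX; have mX : @measurable _ (borel_rV R n) X.
  apply: measurable_closed_rV; apply: compact_closed cX.
  exact: (@norm_hausdorff R 'rV[R]_n).
have bX (p : {mpoly R[n]}) : exists M, forall x, X x -> `|peval p x| <= M.
  have /compact_bounded[M [_ MX]] : compact (peval p @` X).
    apply: continuous_compact => //; apply: continuous_subspaceT.
    exact: continuous_peval.
  by exists (M + 1) => x Xx; apply: (MX _ (ltr_pwDr _ _)) => //; exists x.
have dX (x : borel_rV R n) (p : {mpoly R[n]}) : X x ->
    (\int[\d_x]_(y in X) (peval p y)%:E = (peval p x)%:E)%E.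
  move=> Xx; rewrite integral_dirac; [|exact: mX|].
    by rewrite diracE mem_set // mul1e.
  by apply/measurable_EFinP; exact: measurable_peval.
elim=> [x Xx|t x {}z t01 Xx _ [nu nuX nuE]].
  exists (@dirac _ (borel_rV R n) x R) => [|a]; first by rewrite /= diracE mem_set.
  by rewrite dX // ffunE.
have [P [PE PI]] := probability_mix nu (@dirac _ (borel_rV R n) x R) t01.
exists P => [|a].
  by rewrite PE nuX /= diracE mem_set // !mule1 -EFinD subrK.
have [M pM] := bX (mpolyX R a).
by rewrite (PI _ _ M) ?dX -?nuE ?ffunE //; exact: measurable_peval.
Qed.

End BorelMoments.

(** * Distance to the hull by supporting linear forms *)

Section MomentDistance.
Variables (R : realType) (n : nat).

Lemma riesz_restrict d k (y : {ffun mexp n d -> R}) (a : mexp n k) :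
  (k <= d)%N -> riesz y (mpolyX R a) = mom_restrict k y a.
Proof.
move=> kd; have ad : (mdeg a < d.+1)%N by rewrite (leq_trans (bmdeg a)).
rewrite ffunE (insubT (fun b : multinom n => mdeg b < d.+1)%N ad) /=.
rewrite /riesz (bigD1 (Sub (bmnm a) ad)) //= mcoeffX eqxx mul1r big1 ?addr0 // => b ba.
rewrite mcoeffX (_ : (_ == _) = false) ?mul0r //; apply/negbTE.
by apply: contraNneq ba => ab; apply/eqP/val_inj.
Qed.

Definition sqdist k (y z : {ffun mexp n k -> R}) : R := \sum_a (y a - z a) ^+ 2.

Lemma sqdist_ge0 k (y z : {ffun mexp n k -> R}) : 0 <= sqdist y z.
Proof. by apply: sumr_ge0 => a _; exact: sqr_ge0. Qed.

(** Takes the place of an exact projection, which would call for an attained infimum. *)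
Lemma near_minimizer (T : Type) (S : T -> Prop) (Q : T -> R) (e : R) :
    0 < e -> (exists z, S z) -> (forall z, S z -> 0 <= Q z) ->
  exists2 z, S z & forall z', S z' -> Q z <= Q z' + e.
Proof.
move=> e0 [z0 Sz0] Q0; pose E := [set Q z | z in [set z | S z]].
have infE : has_inf E.
  by split; [exists (Q z0), z0 | exists 0 => _ [z Sz <-]; exact: Q0].
have [_ [z Sz <-] Qz] := inf_adherent e0 infE.
exists z => // z' Sz'; apply: (le_trans (ltW Qz)); rewrite lerD2r.
by apply: ge_inf; [case: infE | exists z'].
Qed.

Lemma mom_hull_bounded (X : set 'rV[R]_n) k (B : R) (z : {ffun mexp n k -> R}) :
    (forall (a : mexp n k) x, X x -> `|peval (mpolyX R a) x| <= B) ->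
  mom_hull X z -> forall a, `|z a| <= B.
Proof.
move=> XB; elim=> [x Xx|t x {}z /andP[t0 t1] Xx _ IH] a; first by rewrite ffunE XB.
rewrite !ffunE; apply: (le_trans (ler_normD _ _)); rewrite !normrM.
have t1' : 0 <= 1 - t by rewrite subr_ge0.
rewrite (ger0_norm t1') (ger0_norm t0).
have := ler_wpM2l t0 (XB a x Xx).
by have := ler_wpM2l t1' (IH a); lra.
Qed.

(* A near-projection [z] of [y] on the hull supports it up to a small error, in
   the direction [z - y]; a lower bound for the linear form [z - y] that also
   holds at [y], up to [A * del], hence bounds the distance. *)
Lemma hull_dist_le (X : set 'rV[R]_n) k (y : {ffun mexp n k -> R}) (B del : R) :
    X !=set0 -> 0 <= del ->
    (forall (a : mexp n k) x, X x -> `|peval (mpolyX R a) x| <= B) ->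
    (forall (u : {ffun mexp n k -> R}) (A b : R), 0 < A ->
       (forall a, `|u a| <= A) ->
       (forall x, X x -> b <= \sum_a u a * peval (mpolyX R a) x) ->
       b - A * del <= \sum_a u a * y a) ->
  forall e, 0 < e -> exists2 z, mom_hull X z & mvec_dist y z <= del + e.
Proof.
move=> [x0 Xx0] del0 XB supp e e0.
pose M := \sum_(a : mexp n k) (2 * B) ^+ 2.
have M0 : 0 <= M by apply: sumr_ge0 => a _; exact: sqr_ge0.
have M1 : 0 < M + 1 by rewrite ltr_wpDl.
(* [M] bounds the squared length of any segment from [z] to a point moment vector, so mixing with
   weight [t] has a second-order effect of at most [t * e ^ 2], the slack allowed to [z]. *)
pose t := Num.min 1 (e ^+ 2 / (M + 1)).
have e2 : 0 < e ^+ 2 by rewrite exprn_gt0.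
have t0 : 0 < t by rewrite lt_min ltr01 divr_gt0.
have t1 : t <= 1 by rewrite ge_min lexx.
have tM : t * M <= e ^+ 2.
  apply: (@le_trans _ _ (t * (M + 1))); first by rewrite ler_wpM2l ?lerDl // ltW.
  by rewrite -ler_pdivlMr // ge_min lexx orbT.
have te : 0 < t * e ^+ 2 by rewrite mulr_gt0.
have [z zX zmin] := @near_minimizer _ (@mom_hull R n X k) (sqdist y) _ te
  (ex_intro _ _ (mom_hull_pt k Xx0)) (fun z _ => sqdist_ge0 y z).
exists z => //; set A := mvec_dist y z.
have A2 : A ^+ 2 = sqdist y z by rewrite sqr_sqrtr // sqdist_ge0.
rewrite leNgt; apply/negP => deA.
have A0 : 0 < A by rewrite (le_lt_trans _ deA) // addr_ge0 // ltW.
pose u : {ffun mexp n k -> R} := [ffun a => z a - y a].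
(* Near-minimality of [z] along the segment to any [dirac_moments k x] gives, after division by [t],
   that [u] loses at most [e ^ 2] from [z] to that point. *)
pose b := \sum_a u a * z a - e ^+ 2.
suff h : b - A * del <= \sum_a u a * y a.
  have uy : \sum_a u a * y a = \sum_a u a * z a - A ^+ 2.
    rewrite A2 -sumrB; apply: eq_bigr => a _; rewrite ffunE; ring.
  (* The inequality reads [A ^ 2 <= A * del + e ^ 2], impossible for [A > del + e]. *)
  by move: h; rewrite uy /b; nra.
apply: supp => // [a|x Xx].
- rewrite ffunE -ler_sqr ?nnegrE ?(ltW A0) // A2 -normrX ger0_norm ?sqr_ge0 //.
  rewrite /sqdist (bigD1 a) //= -(opprB (y a)) sqrrN lerDl.
  by apply: sumr_ge0 => *; exact: sqr_ge0.
- have t01 : 0 <= t <= 1 by rewrite ltW.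
  have := zmin _ (mom_hull_mix t01 Xx zX).
  pose v := dirac_moments k x.
  have -> : sqdist y [ffun a => (1 - t) * z a + t * dirac_moments k x a] =
      sqdist y z + 2 * t * \sum_a u a * (v a - z a) + t ^+ 2 * \sum_a (v a - z a) ^+ 2.
    rewrite /sqdist !mulr_sumr -!big_split; apply: eq_bigr => a _ /=.
    by rewrite /u /v !ffunE; ring.
  have vM : \sum_a (v a - z a) ^+ 2 <= M.
    apply: ler_sum => a _; rewrite -[leLHS]real_normK ?num_real //.
    have va : `|v a - z a| <= 2 * B.
      apply: (le_trans (ler_normB _ _)); rewrite mulrDl mul1r lerD //.
        by rewrite ffunE XB.
      exact: mom_hull_bounded zX a.
    by rewrite ler_sqr ?nnegrE // (le_trans _ va).
  rewrite /b; have -> : \sum_a u a * peval (mpolyX R (bmnm a)) x =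
    \sum_a u a * z a + \sum_a u a * (v a - z a).
    by rewrite -big_split; apply: eq_bigr => a _ /=; rewrite -mulrDr addrC subrK [v a]ffunE.
  move: (\sum_a u a * (v a - z a)) (\sum_a _ ^+ 2) vM => p q qM.
  have := ler_wpM2l (ltW t0) qM; move=> tq h.
  have h1 : 0 <= t * (2 * p + t * q + e ^+ 2) by move: h; lra.
  by move: h1; rewrite pmulr_rge0 //; lra.
Qed.

End MomentDistance.

(** * Convergence rates *)

Section Rates.
Variables (R : realType) (n m : nat) (g : 'I_m -> {mpoly R[n]}) (rad : R).
Hypothesis rad_gt0 : 0 < rad.
Hypothesis X_nonempty : feasible g !=set0.
Hypothesis X_compact : compact (feasible g).
Hypothesis X_ball : forall x : 'rV[R]_n, feasible g x -> enorm x <= rad.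
Hypothesis X_CQC : CQC g.
Let G := with_ball g rad.

Let X_inbox x (fx : feasible g x) : inbox rad x.
Proof. by apply: (feasible_inbox _ X_ball fx); exact: ltW. Qed.

Lemma cert_min_rate f fmin : is_min_on f (feasible g) fmin ->
  exists (C : R) (r0 : nat), forall r, (r0 <= r)%N ->
    (pdeg f <= 2 * r)%N /\ cert G r (f - mpolyC n (fmin - C / r%:R)).
Proof.
move=> [_ fX]; have [C C0 [r0 H]] :=
  cert_lower_bound rad_gt0 X_nonempty X_inbox X_CQC (pdeg f).
have [L L0 fL] := smooth_poly (2 * rad) f.
(* [L + 1] is a strictly positive Lipschitz constant, and [r >= pdeg f] ensures that [riesz] sees
   every term of [f]. *)
exists (C * (L + 1)), (maxn r0 (pdeg f)) => r.
rewrite geq_max => /andP[r0r fr]; split; first by lia.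
rewrite mpolyCB opprB addrCA addrC; apply: H => //; first by rewrite ltr_wpDl.
move=> x y xr yr; have [_ + _] := fL y x yr xr; move=> /le_trans; apply.
by rewrite ler_wpM2r ?l1norm_ge0 // lerDl.
Qed.

(** A linear form with coefficients bounded by [A] has degree at most [k] and Lipschitz constant
    [K * A * B]. One constant of [cert_lower_bound] thus serves every pseudo-moment vector and every
    direction in [hull_dist_le]. *)
Lemma moment_dist_rate k :
  bigO_inv (moment_dist (feasible g) (moment_preordering G) k).
Proof.
have [C C0 [r0 H]] := cert_lower_bound rad_gt0 X_nonempty X_inbox X_CQC k.
have [B B1 BX] : exists2 B : R, 1 <= B &
    forall a : mexp n k, smooth_on (2 * rad) B (mpolyX R a).
  apply: common_bound => [a D E|a]; first exact: smooth_on_le.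
  exact: smooth_poly.
have B0 : 0 < B by rewrite (lt_le_trans ltr01).
have box2 x : feasible g x -> inbox (2 * rad) x.
  move=> /X_inbox xr i; apply: (le_trans (xr i)).
  by rewrite ler_peMl ?(ltW rad_gt0) // ler1n.
have XB (a : mexp n k) x : feasible g x -> `|peval (mpolyX R a) x| <= B.
  by move=> /box2 xr; have [] := BX a x x xr xr.
pose K : R := #|{: mexp n k}|%:R; have K0 : 0 < K.
  by rewrite ltr0n; apply/card_gt0P; exists bm0.
exists (C * (K * B)); near=> r.
have rr0 : (r0 <= r)%N by near: r; exact: nbhs_infty_ge.
have rk : (k <= r)%N by near: r; exact: nbhs_infty_ge.
set del := C * (K * B) / r%:R.
have del0 : 0 <= del by rewrite divr_ge0 // !mulr_ge0 // ltW.
(* The supremum is nonnegative because a feasible point supplies an element; over an empty set it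
   would be [-oo]. *)
rewrite gee0_abs; last first.
  have [x fx] := X_nonempty; apply: le_ereal_sup_tmp.
  have xM := dirac_moment_preordering r (feasible_with_ball (ltW rad_gt0) X_ball fx).
  eexists; first by exists (mom_restrict k (dirac_moments (2 * r) x)) => //;
    exists (dirac_moments (2 * r) x).
  by apply: le_ereal_inf_tmp => _ [z _ <-]; rewrite lee_fin sqrtr_ge0.
apply: ge_ereal_sup => _ [_ [y yM <-] <-].
apply/lee_addgt0Pr => e e0.
have [|z zX yz] := hull_dist_le (y := mom_restrict k y) X_nonempty del0 XB _ e0.
  move=> u A b A0 uA ub; pose f := \sum_a u a *: mpolyX R (bmnm a).
  have fE x : peval f x = \sum_a u a * peval (mpolyX R (bmnm a)) x.
    by rewrite peval_sum; apply: eq_bigr => a _; rewrite pevalZ.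
  have fc : cert G r (f - mpolyC n b + mpolyC n (C * (K * (A * B)) / r%:R)).
    apply: H => //.
    - apply: pdeg_sum_le => a _; apply: (leq_trans (pdegZ_le _ _)).
      by rewrite pdegX; have := bmdeg a.
    - by rewrite !mulr_gt0.
    - move=> x x' xr xr'; rewrite !fE -sumrB; apply: (le_trans (ler_norm_sum _ _ _)).
      have -> : K * (A * B) * l1norm (x - x') =
          \sum_(a : mexp n k) A * (B * l1norm (x - x')).
        by rewrite sumr_const -[RHS]mulr_natl -/K; ring.
      apply: ler_sum => a _; rewrite -mulrBr normrM ler_pM //.
      by have [] := BX a x' x xr' xr.
    - by move=> x fx; rewrite fE; exact: ub.
  have := riesz_cert_ge0 yM fc; have [y0 _ _] := yM.
  rewrite !rieszD -(scaleN1r (mpolyC n b)) rieszZ !rieszC y0 riesz_sum.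
  have -> : \sum_a riesz y (u a *: mpolyX R (bmnm a)) = \sum_a u a * mom_restrict k y a.
    by apply: eq_bigr => a _; rewrite rieszZ riesz_restrict //; lia.
  by have -> : C * (K * (A * B)) / r%:R = A * del by [rewrite /del; ring]; lra.
apply: (le_trans (ereal_inf_lbound _)); first by exists z => //; exact: mom_hull_moments.
by rewrite -EFinD lee_fin.
Unshelve. all: by end_near. Qed.

End Rates.

Theorem corollary4p18 (R : realType) (n m : nat) (g : 'I_m -> {mpoly R[n]})
    (rad : R) (rad_ge1 : 1 <= rad)
    (X_nonempty : feasible g !=set0)
    (X_compact : compact (feasible g))
    (X_ball : forall x : 'rV[R]_n, feasible g x -> enorm x <= rad)
    (X_CQC : CQC g) :
  (forall k : nat, (0 < k)%N ->
     bigO_inv (moment_dist (feasible g)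
                 (moment_preordering (with_ball g rad)) k)) /\
  (forall (f : {mpoly R[n]}) (fmin : R), is_min_on f (feasible g) fmin ->
     [/\ bigO_inv (fun r => fmin%:E - mlb f (moment_reduced (with_ball g rad)) r)%E,
         bigO_inv (fun r => fmin%:E - lb f (reduced (with_ball g rad)) r)%E,
         bigO_inv (fun r => fmin%:E - mlb f (moment_preordering (with_ball g rad)) r)%E
       & bigO_inv (fun r => fmin%:E - lb f (preordering (with_ball g rad)) r)%E]).
Proof.
have rad0 : 0 < rad by rewrite (lt_le_trans ltr01).
split=> [k _|f fmin fmP]; first exact: moment_dist_rate.
have [C [r0 H]] := cert_min_rate rad0 X_nonempty X_ball X_CQC fmP.
have [[x fx fxE] _] := fmP.
have mlbO : bigO_inv (fun r => fmin%:E - mlb f (moment_preordering (with_ball g rad)) r)%E.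
  apply: (@bigO_inv_lower _ _ C r0) => r /H [fr fc]; apply/andP; split.
    exact: le_mlb fc.
  by rewrite -fxE; exact: mlb_le (ltW rad0) X_ball _ _ _ fx fr.
have lbO : bigO_inv (fun r => fmin%:E - lb f (preordering (with_ball g rad)) r)%E.
  apply: (@bigO_inv_lower _ _ C r0) => r /H [fr fc]; apply/andP; split.
    exact: le_lb fc.
  by rewrite -fxE; exact: lb_le (ltW rad0) X_ball _ _ _ fx.
(* The reduced hierarchy unfolds to the preordering one, so two estimates give all four. *)
by split.
Qed.
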